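(* Let $\sigma>0$, $A>0$, and let $f:\mathbb{R}\to\mathbb{R}$ be continuous, bandlimited to $\sigma$ rad/s, satisfy $|f(t)|\le A/(1+t^2)$ for all $t\in\mathbb{R}$, and not be identically zero. For $\alpha>A\sigma$ let $g_\alpha(t)=\alpha t+f(t)$ and $h_\alpha(u)=g_\alpha^{-1}(u)-u/\alpha$. Then, with the exception of at most one value of $\alpha\in(A\sigma,\infty)$, the function $h_\alpha$ is not bandlimited (i.e. there is no $\tau>0$ with $\hat h_\alpha(\xi)=0$ for all $|\xi|>\tau$).
   Context: Fourier transform convention: $\hat f(\xi)=\int_{\mathbb{R}}f(t)e^{-i2\pi\xi t}\,dt$. A function $f\in L^1(\mathbb{R})$ is bandlimited to $\sigma$ rad/s if $\hat f(\xi)=0$ for all $|\xi|>\sigma/(2\pi)$. For $\alpha>A\sigma$, $g_\alpha$ is a strictly increasing bijection of $\mathbb{R}$, so $g_\alpha^{-1}$ is defined on $\mathbb{R}$. *)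

(* Defs.v *)
From Stdlib Require Import Reals.
Open Scope R_scope.

Definition improper_integral (F : R -> R) (l : R) : Prop :=
  (forall a b : R, inhabited (Riemann_integrable F a b)) /\
  forall eps : R, 0 < eps -> exists M : R, forall (a b : R)
    (pr : Riemann_integrable F a b),
    a <= - M -> M <= b -> Rabs (RiemannInt pr - l) < eps.

(* f is in L^1 (for the continuous functions considered here:
   |f| has a finite improper integral). *)
Definition integrable_R (f : R -> R) : Prop :=
  exists I : R, improper_integral (fun t => Rabs (f t)) I.

(* hat f(xi) = int f(t) e^{-i 2 pi xi t} dt = 0, i.e. real and imaginary
   parts (cosine and sine integrals) both vanish. *)
Definition fourier_vanishes_at (f : R -> R) (xi : R) : Prop :=
  improper_integral (fun t => f t * cos (2 * PI * xi * t)) 0 /\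
  improper_integral (fun t => f t * sin (2 * PI * xi * t)) 0.

Definition bandlimited (f : R -> R) (sigma : R) : Prop :=
  integrable_R f /\
  forall xi : R, Rabs xi > sigma / (2 * PI) -> fourier_vanishes_at f xi.

Definition bandlimited_some (h : R -> R) : Prop :=
  exists tau : R, 0 < tau /\
    forall xi : R, Rabs xi > tau -> fourier_vanishes_at h xi.

(* Main.v *)
(* The hypotheses already exclude every [alpha], so the exceptional value is arbitrary.
   A bandlimited function of decay O(1/t^2) is, by Fejér inversion, the restriction to the real line
   of an entire function. Hence so are [g t = alpha t + f t] and, if [h] is bandlimited,
   [G u = u / alpha + h u], and [g (G z) = z] holds on the real line, therefore on the complex plane.
   For [|z| >= 1] the value [G z] stays away from [G 0], so the entire function
   [z / (G z - G 0)], which is the difference quotient of [g] at [G z], has linear growth and is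
   affine by Liouville's argument. As [G x - x / alpha] is bounded on the real line, this affine
   function is the constant [alpha]; so [h] is constant, [f] is constant, and [f = 0] by decay. *)

Require Import Defs.
From Stdlib Require Import Reals Lra Lia Psatz ClassicalEpsilon RList.
From Coquelicot Require Import Coquelicot.
Open Scope R_scope.

(** * Riemann integrals *)

(** What is extracted about [h] is Riemann integrability and decay, not continuity, so inversion
    recovers [h] only where it oscillates little. Such points are dense, and near them the smooth
    function [band_synthesis h b] approximates [h]; hence [G] is built from this synthesis, and
    [g (G u) = u] is obtained as a limit through such points. Fejér means suit this because their
    kernel is positive with integrable decay: an error [e] in the result requires only oscillation
    [e] near the point. The analysis rests on one real lemma: quadratically small increments force
    constancy. It yields the exchange of integrals, the fundamental theorem along a path and the
    independence of circle means from the radius. The mean value property then replaces Cauchy's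
    formula. For a function cut off below the real axis and weighted by an exponential it gives
    uniqueness of continuation; on large circles it gives Liouville's argument. Division by [z] is
    done by integrating [F' (t z)] over [t] in [0, 1], so no power series enters. *)

Lemma le_of_le_add_div (x y K N0 : R) :
  (forall N, N0 < N -> 0 < N -> x <= y + K / N) -> x <= y.
Proof.
  intros H. apply Rnot_lt_le. intros Hlt.
  set (N := Rmax (N0 + 1) ((Rabs K + 1) / (x - y))).
  assert (HN1 : N0 + 1 <= N) by apply Rmax_l.
  assert (HN2 : (Rabs K + 1) / (x - y) <= N) by apply Rmax_r.
  assert (HK := Rabs_pos K). assert (HK' := Rle_abs K).
  assert (HN : 0 < N).
  { apply Rlt_le_trans with (2 := HN2). apply Rdiv_lt_0_compat; lra. }
  specialize (H N ltac:(lra) HN).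
  assert (HB : Rabs K + 1 <= N * (x - y)).
  { apply Rmult_le_compat_r with (r := x - y) in HN2; [|lra].
    replace ((Rabs K + 1) / (x - y) * (x - y)) with (Rabs K + 1) in HN2 by (field; lra).
    exact HN2. }
  assert (HC : x - y <= K / N) by lra.
  apply Rmult_le_compat_r with (r := N) in HC; [|lra].
  replace (K / N * N) with K in HC by (field; lra). lra.
Qed.

(** Cutting [p, q] into n equal steps bounds the total increment by n K ((q - p) / n)^2, which tends
    to 0. This stands in for the fact that a vanishing derivative forces constancy, without
    requiring [D] to be differentiable in advance. *)
Lemma quadratic_increments_constant (D : R -> R) (K p q : R) :
  p <= q ->
  (forall x y, p <= x -> x <= y -> y <= q -> Rabs (D y - D x) <= K * (y - x) ^ 2) ->
  D q = D p.
Proof.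
  intros Hpq H.
  assert (Hk : forall (n k : nat), (0 < n)%nat -> (k <= n)%nat ->
    Rabs (D (p + INR k * ((q - p) / INR n)) - D p) <= INR k * (K * ((q - p) / INR n) ^ 2)).
  { intros n k Hn. assert (Hn' : 0 < INR n) by (apply lt_0_INR; lia).
    set (d := (q - p) / INR n).
    assert (Hd : 0 <= d) by (apply Rdiv_le_0_compat; lra).
    assert (Hnd : INR n * d = q - p) by (unfold d; field; lra).
    induction k as [|k IH]; intros Hkn.
    - simpl. replace (p + 0 * d) with p by ring.
      rewrite Rminus_diag, Rabs_R0. lra.
    - specialize (IH ltac:(lia)).
      assert (HSk : INR (S k) * d <= INR n * d).
      { apply Rmult_le_compat_r; [exact Hd|]. apply le_INR; exact Hkn. }
      rewrite S_INR in *. assert (Hk0 := pos_INR k).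
      assert (Hstep := H (p + INR k * d) (p + (INR k + 1) * d) ltac:(nra) ltac:(nra) ltac:(nra)).
      replace (p + (INR k + 1) * d - (p + INR k * d)) with d in Hstep by ring.
      replace (D (p + (INR k + 1) * d) - D p) with
        ((D (p + (INR k + 1) * d) - D (p + INR k * d)) + (D (p + INR k * d) - D p)) by ring.
      eapply Rle_trans; [apply Rabs_triang|]. lra. }
  assert (H0 : Rabs (D q - D p) <= 0).
  (* [n] is the integer part of [N], and N < n + 1 <= 2 n bounds 1 / n by 2 / N; this is the factor
     2. [Rabs K] is used because the sign of [K] is unknown. *)
  { apply (le_of_le_add_div _ _ (2 * Rabs K * (q - p) ^ 2) 1). intros N HN HN0.
    destruct (nfloor_ex N ltac:(lra)) as [n [Hn1 Hn2]].
    assert (Hn : (0 < n)%nat) by (apply INR_lt; simpl; lra).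
    specialize (Hk n n Hn (le_n n)).
    assert (Hn' : 1 <= INR n) by (apply (le_INR 1); lia).
    replace (p + INR n * ((q - p) / INR n)) with q in Hk by (field; lra).
    eapply Rle_trans; [exact Hk|].
    replace (INR n * (K * ((q - p) / INR n) ^ 2)) with (K * (q - p) ^ 2 / INR n) by (field; lra).
    rewrite Rplus_0_l.
    apply Rle_trans with (Rabs K * (q - p) ^ 2 / INR n).
    { apply Rmult_le_compat_r; [left; apply Rinv_0_lt_compat; lra|].
      apply Rmult_le_compat_r; [apply pow2_ge_0|]. apply Rle_abs. }
    assert (HA0 : 0 <= Rabs K * (q - p) ^ 2) by (apply Rmult_le_pos; [apply Rabs_pos|apply pow2_ge_0]).
    apply Rle_div_l; [lra|].
    replace (2 * Rabs K * (q - p) ^ 2 / N * INR n) with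
      (Rabs K * (q - p) ^ 2 * (2 * INR n / N)) by (field; lra).
    rewrite <- (Rmult_1_r (Rabs K * (q - p) ^ 2)) at 1.
    apply Rmult_le_compat_l; [exact HA0|].
    apply Rle_div_r; lra. }
  assert (H1 := Rabs_pos (D q - D p)).
  assert (H2 : D q - D p = 0).
  { destruct (Req_dec (D q - D p) 0) as [E|E]; [exact E|].
    apply Rabs_pos_lt in E. lra. }
  lra.
Qed.

Lemma ex_RInt_Rplus (f g : R -> R) a b :
  ex_RInt f a b -> ex_RInt g a b -> ex_RInt (fun x => f x + g x) a b.
Proof. exact (ex_RInt_plus f g a b). Qed.

Lemma ex_RInt_Rminus (f g : R -> R) a b :
  ex_RInt f a b -> ex_RInt g a b -> ex_RInt (fun x => f x - g x) a b.
Proof. exact (ex_RInt_minus f g a b). Qed.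

Lemma ex_RInt_Rscal (f : R -> R) k a b :
  ex_RInt f a b -> ex_RInt (fun x => k * f x) a b.
Proof. exact (ex_RInt_scal f a b k). Qed.

Lemma RInt_Rplus (f g : R -> R) a b :
  ex_RInt f a b -> ex_RInt g a b ->
  RInt (fun x => f x + g x) a b = RInt f a b + RInt g a b.
Proof. exact (RInt_plus f g a b). Qed.

Lemma RInt_Rminus (f g : R -> R) a b :
  ex_RInt f a b -> ex_RInt g a b ->
  RInt (fun x => f x - g x) a b = RInt f a b - RInt g a b.
Proof. exact (RInt_minus f g a b). Qed.

Lemma RInt_Rscal (f : R -> R) k a b :
  ex_RInt f a b -> RInt (fun x => k * f x) a b = k * RInt f a b.
Proof. exact (RInt_scal f a b k). Qed.

Lemma RInt_Rext (f g : R -> R) a b :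
  (forall x : R, Rmin a b < x < Rmax a b -> f x = g x :> R) -> RInt f a b = RInt g a b :> R.
Proof. exact (RInt_ext f g a b). Qed.

Lemma RInt_Rpoint (f : R -> R) a : RInt f a a = 0 :> R.
Proof. exact (RInt_point (V := R_CompleteNormedModule) a f). Qed.

Lemma RInt_Rconst (c a b : R) : RInt (fun _ => c) a b = (b - a) * c.
Proof. exact (RInt_const a b c). Qed.

Lemma RInt_Chasles_R (f : R -> R) a b c :
  ex_RInt f a b -> ex_RInt f b c -> RInt f a c = RInt f a b + RInt f b c.
Proof. intros H1 H2. symmetry. exact (RInt_Chasles f a b c H1 H2). Qed.

Lemma ex_RInt_continuity (f : R -> R) a b :
  continuity f -> ex_RInt f a b.
Proof.
  intros H. apply (ex_RInt_continuous (V := R_CompleteNormedModule)).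
  intros z _. apply continuity_pt_filterlim. apply H.
Qed.

(** A step function approximating [g] also approximates [f] once its error function is raised by the
    constant bounding |f - g|. That constant is small enough for its integral to stay below a
    quarter of [eps], while the error of [g] takes half. *)
Lemma ex_RInt_uniform_approx (f : R -> R) (a b : R) :
  a <= b ->
  (forall eps, 0 < eps -> exists g, ex_RInt g a b /\
     forall x, a <= x <= b -> Rabs (f x - g x) <= eps) ->
  ex_RInt f a b.
Proof.
  intros Hab H. apply ex_RInt_Reals_1. intros eps.
  assert (HE : 0 < eps / (4 * (b - a + 1))).
  { apply Rdiv_lt_0_compat; [apply cond_pos|lra]. }
  assert (Hc : exists g, ex_RInt g a b /\ (forall x, a <= x <= b ->
     Rabs (f x - g x) <= eps / (4 * (b - a + 1)))) by (apply H; exact HE).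
  assert (S1 : {g : R -> R | ex_RInt g a b /\ (forall x, a <= x <= b ->
     Rabs (f x - g x) <= eps / (4 * (b - a + 1)))}).
  { apply constructive_indefinite_description. exact Hc. }
  destruct S1 as [g [Hg Hfg]].
  destruct (ex_RInt_Reals_0 g a b Hg (mkposreal (eps / 2) (is_pos_div_2 eps)))
    as [phi [psi [Hpsi1 Hpsi2]]].
  exists phi.
  set (cst := mkStepFun (StepFun_P4 a b (eps / (4 * (b - a + 1))))).
  exists (mkStepFun (StepFun_P28 1 psi cst)). split.
  - intros t Ht. simpl. unfold fct_cte.
    rewrite Rmin_left, Rmax_right in Ht by exact Hab.
    assert (H1 := Hfg t Ht).
    assert (H2 := Hpsi1 t). rewrite Rmin_left, Rmax_right in H2 by exact Hab.
    specialize (H2 Ht).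
    replace (f t - phi t) with ((f t - g t) + (g t - phi t)) by ring.
    eapply Rle_trans; [apply Rabs_triang|]. lra.
  - rewrite StepFun_P30. unfold cst. rewrite StepFun_P18.
    simpl in Hpsi2.
    eapply Rle_lt_trans; [apply Rabs_triang|].
    assert (H3 : Rabs (1 * (eps / (4 * (b - a + 1)) * (b - a))) <= eps / 4).
    { assert (Hep := cond_pos eps).
      rewrite Rmult_1_l, Rabs_right.
      - apply Rle_trans with (eps / (4 * (b - a + 1)) * (b - a + 1)).
        + apply Rmult_le_compat_l; lra.
        + right. field. lra.
      - apply Rle_ge. apply Rmult_le_pos; lra. }
    assert (Hep := cond_pos eps). lra.
Qed.

(** By uniform continuity, [c] is nearly its left-end value on each piece of length [e], where the
    product is thus close to a scalar multiple of [f]. The induction on the number of pieces glues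
    these multiples into one integrable approximant. *)
Lemma ex_RInt_mult_continuity_le (f c : R -> R) (a b : R) :
  a <= b -> ex_RInt f a b -> continuity c -> ex_RInt (fun x => f x * c x) a b.
Proof.
  intros Hab Hf Hc. apply ex_RInt_uniform_approx; [exact Hab|].
  intros eps Heps.
  destruct (ex_RInt_ub f a b Hf) as [M HM].
  rewrite Rmin_left, Rmax_right in HM by exact Hab.
  assert (HM0 : 0 <= M).
  { eapply Rle_trans; [|apply (HM a); lra]. apply norm_ge_0. }
  assert (HeM : 0 < eps / (M + 1)) by (apply Rdiv_lt_0_compat; lra).
  destruct (Heine_cor2 (f := c) (a := a) (b := b) (fun x _ => Hc x)
    (mkposreal _ HeM)) as [d Hd].
  simpl in Hd. assert (Hdp := cond_pos d).
  set (e := d / 2). assert (He : 0 < e) by (unfold e; lra).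
  assert (Hind : forall (n : nat) a', a <= a' -> a' <= b -> b <= a' + INR n * e ->
    exists g, ex_RInt g a' b /\ forall x, a' <= x <= b -> Rabs (f x * c x - g x) <= eps).
  { assert (Hloc : forall a' x, a <= a' -> a' <= x -> x <= b -> x <= a' + e ->
      Rabs (f x * c x - c a' * f x) <= eps).
    { intros a' x H1 H2 H3 H4.
      replace (f x * c x - c a' * f x) with (f x * (c x - c a')) by ring.
      rewrite Rabs_mult.
      assert (HA : Rabs (c x - c a') <= eps / (M + 1)).
      { left. apply Hd; try lra. rewrite Rabs_right; unfold e in *; lra. }
      assert (HB : Rabs (f x) <= M) by (apply (HM x); lra).
      apply Rle_trans with (M * (eps / (M + 1))).
      - apply Rmult_le_compat; try apply Rabs_pos; assumption.
      - replace (M * (eps / (M + 1))) with (eps * (M / (M + 1))) by (field; lra).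
        rewrite <- (Rmult_1_r eps) at 2. apply Rmult_le_compat_l; [lra|].
        apply Rle_div_l; lra. }
    induction n as [|n IH]; intros a' H1 H2 H3.
    - exists (fun x => c a' * f x). simpl in H3. split.
      + apply ex_RInt_Rscal.
        replace a' with b by lra. apply ex_RInt_point.
      + intros x Hx. apply Hloc; lra.
    - rewrite S_INR in H3. destruct (Rle_dec b (a' + e)) as [Hle|Hgt].
      + exists (fun x => c a' * f x). split.
        * apply ex_RInt_Rscal. apply (ex_RInt_Chasles_2 (V := R_CompleteNormedModule)) with a; [lra|exact Hf].
        * intros x Hx. apply Hloc; lra.
      + destruct (IH (a' + e) ltac:(lra) ltac:(lra) ltac:(nra)) as [g [Hg1 Hg2]].
        exists (fun x => if Rle_dec (a' + e) x then g x else c a' * f x). split.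
        * apply ex_RInt_Chasles with (a' + e).
          -- apply ex_RInt_ext with (fun x => c a' * f x).
             ++ intros x. rewrite Rmin_left, Rmax_right by lra. intros Hx.
                destruct (Rle_dec (a' + e) x); [lra|reflexivity].
             ++ apply ex_RInt_Rscal.
                apply (ex_RInt_Chasles_1 (V := R_CompleteNormedModule)) with b; [lra|].
                apply (ex_RInt_Chasles_2 (V := R_CompleteNormedModule)) with a; [lra|exact Hf].
          -- apply ex_RInt_ext with g; [|exact Hg1].
             intros x. rewrite Rmin_left, Rmax_right by lra. intros Hx.
             destruct (Rle_dec (a' + e) x); [reflexivity|lra].
        * intros x Hx. destruct (Rle_dec (a' + e) x).
          -- apply Hg2; lra.
          -- apply Hloc; lra. }
  destruct (nfloor_ex ((b - a) / e)) as [n [_ Hn]].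
  { apply Rdiv_le_0_compat; lra. }
  apply (Hind (S n) a); try lra.
  rewrite S_INR. apply Rmult_lt_compat_r with (r := e) in Hn; [|lra].
  replace ((b - a) / e * e) with (b - a) in Hn by (field; lra). lra.
Qed.

Lemma ex_RInt_mult_continuity (f c : R -> R) (a b : R) :
  ex_RInt f a b -> continuity c -> ex_RInt (fun x => f x * c x) a b.
Proof.
  intros Hf Hc. destruct (Rle_dec a b) as [H|H].
  - apply ex_RInt_mult_continuity_le; assumption.
  - apply ex_RInt_swap, ex_RInt_mult_continuity_le; try assumption; [lra|].
    apply ex_RInt_swap, Hf.
Qed.

Lemma continuity_lipschitz (c : R -> R) (L : R) :
  (forall x y, Rabs (c x - c y) <= L * Rabs (x - y)) -> continuity c.
Proof.
  intros H x eps Heps. exists (eps / (Rabs L + 1)).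
  assert (HL := Rabs_pos L). assert (HL' := Rle_abs L).
  assert (Hd : 0 < eps / (Rabs L + 1)) by (apply Rdiv_lt_0_compat; lra).
  split; [exact Hd|]. intros y [_ Hy]. simpl in *. unfold Rdist in *.
  apply Rle_lt_trans with (1 := H y x).
  assert (H0 := Rabs_pos (y - x)).
  apply Rle_lt_trans with (Rabs L * Rabs (y - x)).
  { apply Rmult_le_compat_r; lra. }
  apply Rle_lt_trans with (Rabs L * (eps / (Rabs L + 1))).
  { apply Rmult_le_compat_l; lra. }
  replace (Rabs L * (eps / (Rabs L + 1))) with (eps - eps / (Rabs L + 1)) by (field; lra).
  lra.
Qed.

(* [f] is only Riemann integrable, so continuity of the integrand cannot be used;
   the difference of the two sides, as a function of the upper bound [N], has
   quadratic increments and hence is constant. *)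
Lemma RInt_swap (f : R -> R) (e : R -> R -> R) (a b N P L L' : R) :
  a <= b -> 0 <= N < P -> ex_RInt f a b -> 0 <= L ->
  (forall x, continuity (fun w => e w x)) ->
  (forall w, continuity (e w)) ->
  (forall w w' x, Rabs w <= P -> Rabs w' <= P -> a <= x <= b ->
     Rabs (e w x - e w' x) <= L * Rabs (w - w')) ->
  (forall w x y, Rabs w <= P -> Rabs (e w x - e w y) <= L' * Rabs (x - y)) ->
  ex_RInt (fun w => RInt (fun x => f x * e w x) a b) 0 N /\
  RInt (fun w => RInt (fun x => f x * e w x) a b) 0 N =
  RInt (fun x => f x * RInt (fun w => e w x) 0 N) a b :> R.
Proof.
  intros Hab HN Hf HL Hcw Hcx HLw HLx.
  destruct (ex_RInt_ub f a b Hf) as [M HM].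
  rewrite Rmin_left, Rmax_right in HM by exact Hab.
  assert (HM0 : 0 <= M).
  { eapply Rle_trans; [|apply (HM a); lra]. apply norm_ge_0. }
  assert (Hbd : forall c s, continuity c -> (forall x, a <= x <= b -> Rabs (c x) <= s) ->
    Rabs (RInt (fun x => f x * c x) a b) <= (b - a) * (M * s)).
  { intros c s Hc Hs. apply abs_RInt_le_const; [exact Hab| |].
    - apply ex_RInt_mult_continuity; assumption.
    - intros t Ht. rewrite Rabs_mult.
      apply Rmult_le_compat; try apply Rabs_pos; [apply (HM t Ht)|apply Hs, Ht]. }
  assert (Hmin : forall c c', continuity c -> continuity c' ->
    RInt (fun x => f x * c x) a b - RInt (fun x => f x * c' x) a b =
    RInt (fun x => f x * (c x - c' x)) a b).
  { intros c c' Hc Hc'.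
    rewrite <- RInt_Rminus by (apply ex_RInt_mult_continuity; assumption).
    apply RInt_Rext. intros x _. ring. }
  set (G := fun w => RInt (fun x => f x * e w x) a b).
  assert (HG : forall w w', Rabs w <= P -> Rabs w' <= P ->
    Rabs (G w - G w') <= ((b - a) * (M * L)) * Rabs (w - w')).
  { intros w w' Hw Hw'. unfold G. rewrite Hmin by apply Hcx.
    replace ((b - a) * (M * L) * Rabs (w - w')) with ((b - a) * (M * (L * Rabs (w - w')))) by ring.
    apply Hbd.
    - apply continuity_minus; apply Hcx.
    - intros x Hx. apply HLw; assumption. }
  set (KG := (b - a) * (M * L)) in *.
  assert (HKG : 0 <= KG) by (unfold KG; repeat apply Rmult_le_pos; lra).
  assert (exG : forall X Y, 0 <= X <= N -> 0 <= Y <= N -> ex_RInt G X Y).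
  { intros X Y HX HY. apply (ex_RInt_continuous (V := R_CompleteNormedModule)).
    intros z Hz.
    assert (Hz' : 0 <= z <= N).
    { split.
      - eapply Rle_trans; [|apply Hz]. apply Rmin_glb; lra.
      - eapply Rle_trans; [apply Hz|]. apply Rmax_lub; lra. }
    apply continuity_pt_filterlim. intros eps Heps.
    (* Continuity of [G] at an end of [0, N] involves frequencies outside that interval; [P - N] is
       the margin in which the Lipschitz bound still holds. *)
    assert (Hd : 0 < Rmin (P - N) (eps / (KG + 1))).
    { apply Rmin_glb_lt; [lra|]. apply Rdiv_lt_0_compat; lra. }
    exists (Rmin (P - N) (eps / (KG + 1))). split; [exact Hd|].
    intros y [_ Hy]. simpl in *. unfold Rdist in *.
    assert (Hy1 := Rlt_le_trans _ _ _ Hy (Rmin_l _ _)).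
    assert (Hy2 := Rlt_le_trans _ _ _ Hy (Rmin_r _ _)).
    apply Rabs_def2 in Hy1.
    eapply Rle_lt_trans; [apply HG; apply Rabs_le; lra|].
    apply Rle_lt_trans with (KG * (eps / (KG + 1))).
    { apply Rmult_le_compat_l; lra. }
    assert (0 < eps / (KG + 1)) by (apply Rdiv_lt_0_compat; lra).
    replace (KG * (eps / (KG + 1))) with (eps - eps / (KG + 1)) by (field; lra). lra. }
  assert (exe : forall x X Y, ex_RInt (fun w => e w x) X Y).
  { intros x X Y. apply ex_RInt_continuity, Hcw. }
  assert (Hce : forall X Y, 0 <= X -> X <= Y -> Y <= N ->
    continuity (fun x => RInt (fun w => e w x) X Y)).
  { intros X Y HX HXY HY. apply (continuity_lipschitz _ ((Y - X) * L')). intros x y.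
    rewrite <- RInt_Rminus by apply exe. rewrite Rmult_assoc.
    apply abs_RInt_le_const; [exact HXY| |].
    - apply ex_RInt_Rminus; apply exe.
    - intros w Hw. apply HLx. apply Rabs_le; lra. }
  split; [apply exG; lra|].
  set (D := fun X => RInt G 0 X - RInt (fun x => f x * RInt (fun w => e w x) 0 X) a b).
  assert (HD : D N = D 0).
  { apply (quadratic_increments_constant D (2 * KG)); [lra|].
    intros X Y HX HXY HY. unfold D.
    rewrite (RInt_Chasles_R G 0 X Y) by (apply exG; lra).
    assert (E1 : RInt (fun x => f x * RInt (fun w => e w x) 0 Y) a b -
                 RInt (fun x => f x * RInt (fun w => e w x) 0 X) a b =
                 RInt (fun x => f x * RInt (fun w => e w x) X Y) a b).
    { rewrite Hmin by (apply Hce; lra). apply RInt_Rext. intros x _.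
      rewrite (RInt_Chasles_R (fun w => e w x) 0 X Y) by apply exe. ring. }
    (* From [X] to [Y] both sides grow by [(Y - X) * G X] up to [KG * (Y - X) ^ 2]: [E2] treats the
       iterated integral and [E3] the exchanged one. *)
    assert (E2 : Rabs (RInt G X Y - (Y - X) * G X) <= (Y - X) * (KG * (Y - X))).
    { rewrite <- (RInt_Rconst (G X)).
      rewrite <- RInt_Rminus; [|apply exG; lra|apply ex_RInt_const].
      apply abs_RInt_le_const; [exact HXY| |].
      - apply ex_RInt_Rminus; [apply exG; lra|apply ex_RInt_const].
      - intros w Hw. eapply Rle_trans; [apply HG; apply Rabs_le; lra|].
        apply Rmult_le_compat_l; [exact HKG|]. rewrite Rabs_right; lra. }
    assert (E3 : Rabs (RInt (fun x => f x * RInt (fun w => e w x) X Y) a b - (Y - X) * G X)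
              <= (b - a) * (M * ((Y - X) * (L * (Y - X))))).
    { unfold G. rewrite <- RInt_Rscal by (apply ex_RInt_mult_continuity; [exact Hf|apply Hcx]).
      rewrite (RInt_Rext (fun x => (Y - X) * (f x * e X x)) (fun x => f x * ((Y - X) * e X x)))
        by (intros; ring).
      assert (Hc2 : continuity (fun x => (Y - X) * e X x)).
      { apply continuity_mult; [apply continuity_const; intros ? ?; reflexivity|apply Hcx]. }
      rewrite Hmin; [|apply Hce; lra|exact Hc2].
      apply Hbd.
      - apply continuity_minus; [apply Hce; lra|exact Hc2].
      - intros x Hx. rewrite <- (RInt_Rconst (e X x)).
        rewrite <- RInt_Rminus; [|apply exe|apply ex_RInt_const].
        apply abs_RInt_le_const; [exact HXY| |].
        + apply ex_RInt_Rminus; [apply exe|apply ex_RInt_const].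
        + intros w Hw. eapply Rle_trans; [apply HLw; [apply Rabs_le; lra|apply Rabs_le; lra|exact Hx]|].
          apply Rmult_le_compat_l; [exact HL|]. rewrite Rabs_right; lra. }
    replace ((b - a) * (M * ((Y - X) * (L * (Y - X))))) with (KG * (Y - X) ^ 2) in E3 by (unfold KG; ring).
    replace ((Y - X) * (KG * (Y - X))) with (KG * (Y - X) ^ 2) in E2 by ring.
    apply Rabs_le_between in E2. apply Rabs_le_between in E3. apply Rabs_le_between.
    lra. }
  assert (HD0 : D 0 = 0).
  { unfold D. rewrite RInt_Rpoint.
    rewrite (RInt_Rext (fun x => f x * RInt (fun w => e w x) 0 0) (fun _ => 0)).
    - rewrite RInt_Rconst. ring.
    - intros x _. rewrite RInt_Rpoint. ring. }
  rewrite HD0 in HD. apply Rminus_diag_uniq. exact HD.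
Qed.

Lemma abs_RInt_inv_sqr_right (f : R -> R) (C M p q : R) :
  0 <= C -> 0 < M -> M <= p -> p <= q -> ex_RInt f p q ->
  (forall t, p <= t <= q -> Rabs (f t) <= C / t ^ 2) ->
  Rabs (RInt f p q) <= C / M.
Proof.
  intros HC HM Hp Hpq Hf Hb.
  assert (HI : is_RInt (fun t => C / t ^ 2) p q ((- C / q) - (- C / p))).
  { apply (is_RInt_derive (V := R_CompleteNormedModule) (fun t => - C / t)).
    - intros x Hx. rewrite Rmin_left, Rmax_right in Hx by exact Hpq.
      auto_derive; [lra|]. field. lra.
    - intros x Hx. rewrite Rmin_left, Rmax_right in Hx by exact Hpq.
      apply (ex_derive_continuous (V := R_NormedModule)). auto_derive.
      apply Rgt_not_eq. nra. }
  eapply Rle_trans; [apply abs_RInt_le; assumption|].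
  apply Rle_trans with (RInt (fun t => C / t ^ 2) p q).
  { apply RInt_le; [exact Hpq| | |].
    - apply (ex_RInt_norm f p q Hf).
    - eexists; exact HI.
    - intros x Hx. apply Hb; lra. }
  rewrite (is_RInt_unique _ _ _ _ HI).
  assert (0 <= C / q) by (apply Rdiv_le_0_compat; lra).
  assert (C / p <= C / M).
  { apply Rmult_le_compat_l; [exact HC|]. apply Rinv_le_contravar; lra. }
  unfold Rdiv in *. lra.
Qed.

Lemma RInt_reflect (f : R -> R) (p q : R) :
  ex_RInt f (- q) (- p) ->
  ex_RInt (fun x => f (- x)) p q /\ RInt (fun x => f (- x)) p q = RInt f (- q) (- p) :> R.
Proof.
  intros Hf.
  assert (Hf' : ex_RInt f (-1 * p + 0) (-1 * q + 0)).
  { replace (-1 * p + 0) with (- p) by ring. replace (-1 * q + 0) with (- q) by ring.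
    apply ex_RInt_swap, Hf. }
  assert (H1 := ex_RInt_comp_lin f (-1) 0 p q Hf').
  assert (H2 := RInt_comp_lin f (-1) 0 p q Hf').
  assert (E : forall x, -1 * (-1 * f (-1 * x + 0)) = f (- x)).
  { intros x. replace (-1 * x + 0) with (- x) by ring. ring. }
  split.
  - apply ex_RInt_ext with (2 := ex_RInt_Rscal _ (-1) _ _ H1). intros x _. apply E.
  - rewrite <- (RInt_Rext _ _ p q (fun x _ => E x)).
    change (ex_RInt (fun y => -1 * f (-1 * y + 0)) p q) in H1.
    rewrite (RInt_Rscal _ (-1) _ _ H1).
    change (RInt (fun y => -1 * f (-1 * y + 0)) p q = RInt f (-1 * p + 0) (-1 * q + 0)) in H2.
    rewrite H2.
    replace (-1 * p + 0) with (- p) by ring. replace (-1 * q + 0) with (- q) by ring.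
    rewrite <- (opp_RInt_swap f (- q) (- p)) by exact Hf. unfold opp; simpl. ring.
Qed.

Lemma abs_RInt_inv_sqr_left (f : R -> R) (C M p q : R) :
  0 <= C -> 0 < M -> q <= - M -> p <= q -> ex_RInt f p q ->
  (forall t, p <= t <= q -> Rabs (f t) <= C / t ^ 2) ->
  Rabs (RInt f p q) <= C / M.
Proof.
  intros HC HM Hp Hpq Hf Hb.
  destruct (RInt_reflect f (- q) (- p)) as [H1 H2].
  { rewrite !Ropp_involutive. exact Hf. }
  rewrite !Ropp_involutive in H2. rewrite <- H2.
  apply abs_RInt_inv_sqr_right; try lra; [exact H1|].
  intros t Ht. replace (t ^ 2) with ((- t) ^ 2) by ring. apply Hb; lra.
Qed.

(** Integrability on bounded intervals stands here instead of continuity, so that the predicate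
    covers [h] as well as [f]. *)
Definition decays (f : R -> R) (C : R) : Prop :=
  (forall a b, ex_RInt f a b) /\ forall t, Rabs (f t) <= C / (1 + t ^ 2).

Lemma decays_nonneg f C : decays f C -> 0 <= C.
Proof.
  intros [_ H]. specialize (H 0). assert (H0 := Rabs_pos (f 0)).
  replace (C / (1 + 0 ^ 2)) with C in H by (field; lra). lra.
Qed.

Lemma decays_bounded f C t : decays f C -> Rabs (f t) <= C.
Proof.
  intros H. assert (HC := decays_nonneg _ _ H). destruct H as [_ H].
  eapply Rle_trans; [apply H|]. assert (Ht := pow2_ge_0 t).
  apply Rle_div_l; [lra|]. nra.
Qed.

Lemma decays_inv_sqr f C t : decays f C -> t <> 0 -> Rabs (f t) <= C / t ^ 2.
Proof.
  intros H Ht. assert (HC := decays_nonneg _ _ H). destruct H as [_ H].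
  eapply Rle_trans; [apply H|]. assert (Ht' := pow2_gt_0 t Ht).
  apply Rmult_le_compat_l; [exact HC|]. apply Rinv_le_contravar; lra.
Qed.

Lemma decays_mult f C c :
  decays f C -> continuity c -> (forall t, Rabs (c t) <= 1) -> decays (fun t => f t * c t) C.
Proof.
  intros [H1 H2] Hc Hb. split.
  - intros a b. apply ex_RInt_mult_continuity; [apply H1|exact Hc].
  - intros t. rewrite Rabs_mult. apply Rle_trans with (2 := H2 t).
    rewrite <- (Rmult_1_r (Rabs (f t))) at 2.
    apply Rmult_le_compat_l; [apply Rabs_pos|apply Hb].
Qed.

Lemma RInt_decays_diff f C M p q p' q' :
  decays f C -> 0 < M -> p' <= p -> p <= - M -> M <= q -> q <= q' ->
  Rabs (RInt f p' q' - RInt f p q) <= 2 * C / M.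
Proof.
  intros H HM Hp' Hp Hq Hq'. assert (HC := decays_nonneg _ _ H).
  assert (ex := proj1 H).
  rewrite (RInt_Chasles_R f p' p q'), (RInt_Chasles_R f p q q') by apply ex.
  replace (RInt f p' p + (RInt f p q + RInt f q q') - RInt f p q)
    with (RInt f p' p + RInt f q q') by ring.
  eapply Rle_trans; [apply Rabs_triang|].
  assert (H1 : Rabs (RInt f p' p) <= C / M).
  { apply abs_RInt_inv_sqr_left; try assumption; [apply ex|].
    intros t Ht. apply decays_inv_sqr; [exact H|lra]. }
  assert (H2 : Rabs (RInt f q q') <= C / M).
  { apply abs_RInt_inv_sqr_right; try assumption; [apply ex|].
    intros t Ht. apply decays_inv_sqr; [exact H|lra]. }
  replace (2 * C / M) with (C / M + C / M) by (field; lra). lra.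
Qed.

(** * Fourier inversion *)

(* The integral over the real line, meaningful for functions satisfying [decays]. *)
Definition RIntR (f : R -> R) : R :=
  real (Lim_seq (fun n => RInt f (- (INR n + 1)) (INR n + 1))).

(** Each tail beyond [M] costs at most C / M. This makes the symmetric integrals a Cauchy sequence,
    so that the total function [Lim_seq] yields a genuine limit. The ends [p] and [q] are
    independent because a translation makes the window asymmetric. *)
Lemma RIntR_spec f C M p q :
  decays f C -> 0 < M -> p <= - M -> M <= q -> Rabs (RInt f p q - RIntR f) <= 2 * C / M.
Proof.
  intros H HM Hp Hq. assert (HC := decays_nonneg _ _ H).
  set (u := fun n => RInt f (- (INR n + 1)) (INR n + 1)).
  assert (Hex : ex_finite_lim_seq u).
  { apply ex_lim_seq_cauchy_corr. intros eps. assert (He := cond_pos eps).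
    destruct (nfloor_ex (2 * C / eps)) as [N [_ HN]].
    { apply Rdiv_le_0_compat; lra. }
    assert (Hmn : forall n m, (N <= n)%nat -> (n <= m)%nat -> Rabs (u m - u n) < eps).
    { intros n m Hn Hm. apply le_INR in Hn, Hm. assert (HN0 := pos_INR N).
      apply Rle_lt_trans with (2 * C / (INR N + 1)).
      - apply RInt_decays_diff; try lra. exact H.
      - apply Rlt_div_l; [lra|]. apply Rlt_div_l in HN; lra. }
    exists N. intros n m Hn Hm. destruct (Nat.le_ge_cases n m) as [L|L].
    - rewrite Rabs_minus_sym. apply Hmn; assumption.
    - apply Hmn; assumption. }
  apply Lim_seq_correct' in Hex. fold (RIntR f) in Hex. unfold u in Hex.
  change (real (Lim_seq (fun n : nat => RInt f (- (INR n + 1)) (INR n + 1)))) with (RIntR f) in Hex.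
  apply Rnot_lt_le. intros Hlt.
  apply is_lim_seq_spec in Hex.
  destruct (Hex (mkposreal (Rabs (RInt f p q - RIntR f) - 2 * C / M) ltac:(lra))) as [N HN].
  simpl in HN.
  destruct (nfloor_ex (Rmax (- p) q)) as [n [_ Hn]].
  { apply Rle_trans with q; [lra|apply Rmax_r]. }
  assert (Hn1 := Rle_lt_trans _ _ _ (Rmax_l _ _) Hn).
  assert (Hn2 := Rle_lt_trans _ _ _ (Rmax_r _ _) Hn).
  specialize (HN (max N n) (Nat.le_max_l _ _)).
  assert (Hge := le_INR _ _ (Nat.le_max_r N n)).
  set (m := max N n) in *.
  assert (Hd := RInt_decays_diff f C M p q (- (INR m + 1)) (INR m + 1) H HM
    ltac:(lra) Hp Hq ltac:(lra)).
  assert (Ht := Rabs_triang (RInt f p q - RInt f (- (INR m + 1)) (INR m + 1))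
    (RInt f (- (INR m + 1)) (INR m + 1) - RIntR f)).
  rewrite (Rabs_minus_sym (RInt f p q)) in Ht.
  replace (RInt f p q - RInt f (- (INR m + 1)) (INR m + 1) + (RInt f (- (INR m + 1)) (INR m + 1) - RIntR f))
    with (RInt f p q - RIntR f) in Ht by ring.
  lra.
Qed.

Lemma eq_of_abs_le_div (x y K : R) :
  (forall N, 1 <= N -> Rabs (x - y) <= K / N) -> x = y.
Proof.
  intros H. assert (H0 : Rabs (x - y) <= 0).
  { apply (le_of_le_add_div _ _ K 1). intros N HN _. rewrite Rplus_0_l. apply H. lra. }
  destruct (Req_dec x y) as [E|E]; [exact E|].
  assert (0 < Rabs (x - y)) by (apply Rabs_pos_lt; lra). lra.
Qed.

Lemma RIntR_unique f C l K :
  decays f C -> (forall M, 1 <= M -> exists p q, p <= - M /\ M <= q /\ Rabs (RInt f p q - l) <= K / M) ->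
  RIntR f = l.
Proof.
  intros H Hl. apply (eq_of_abs_le_div _ _ (2 * C + K)). intros N HN.
  destruct (Hl N HN) as [p [q [Hp [Hq Hpq]]]].
  assert (H1 := RIntR_spec f C N p q H ltac:(lra) Hp Hq).
  replace ((2 * C + K) / N) with (2 * C / N + K / N) by (field; lra).
  replace (RIntR f - l) with (- (RInt f p q - RIntR f) + (RInt f p q - l)) by ring.
  eapply Rle_trans; [apply Rabs_triang|]. rewrite Rabs_Ropp. lra.
Qed.

Lemma RInt_le_RIntR f C T :
  decays f C -> 0 <= T -> (forall x, 0 <= f x) -> RInt f (- T) T <= RIntR f.
Proof.
  intros H HT Hf. apply (le_of_le_add_div _ _ (2 * C) T). intros N HN HN0.
  assert (H1 := RIntR_spec f C N (- N) N H HN0 ltac:(lra) ltac:(lra)).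
  apply Rabs_le_between in H1.
  rewrite (RInt_Chasles_R f (- N) (- T) N), (RInt_Chasles_R f (- T) T N) in H1 by apply H.
  assert (0 <= RInt f (- N) (- T)) by (apply RInt_ge_0; [lra|apply H|intros; apply Hf]).
  assert (0 <= RInt f T N) by (apply RInt_ge_0; [lra|apply H|intros; apply Hf]).
  lra.
Qed.

(** * Cosine and sine transforms of functions with decay *)

Lemma cos_lipschitz x y : Rabs (cos x - cos y) <= Rabs (x - y).
Proof.
  destruct (MVT_gen cos y x (fun t => - sin t)) as [c [_ Hc]].
  - intros t _. auto_derive; [exact I|ring].
  - intros t _. apply continuity_cos.
  - rewrite Hc, Rabs_mult. rewrite <- (Rmult_1_l (Rabs (x - y))) at 2.
    apply Rmult_le_compat_r; [apply Rabs_pos|].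
    rewrite Rabs_Ropp. apply Rabs_le, SIN_bound.
Qed.

Lemma sin_lipschitz x y : Rabs (sin x - sin y) <= Rabs (x - y).
Proof.
  rewrite <- !cos_shift. eapply Rle_trans; [apply cos_lipschitz|].
  replace (PI / 2 - x - (PI / 2 - y)) with (- (x - y)) by ring.
  rewrite Rabs_Ropp. apply Rle_refl.
Qed.

Lemma abs_cos_le_1 x : Rabs (cos x) <= 1.
Proof. apply Rabs_le, COS_bound. Qed.

Lemma abs_sin_le_1 x : Rabs (sin x) <= 1.
Proof. apply Rabs_le, SIN_bound. Qed.

Lemma continuity_comp_scal (c : R -> R) (w : R) : continuity c -> continuity (fun x => c (w * x)).
Proof.
  intros Hc. apply (continuity_comp (fun x => w * x) c); [|exact Hc].
  apply (continuity_lipschitz _ (Rabs w)). intros x y.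
  rewrite <- Rabs_mult. right. f_equal. ring.
Qed.

(* [trans cos f] and [trans sin f] are the cosine and sine transforms of [f]
   at the angular frequency [w] in rad/s. *)
Definition trans (c f : R -> R) (w : R) : R := RIntR (fun x => f x * c (w * x)).

Lemma trans_continuity c f C :
  decays f C -> (forall x y, Rabs (c x - c y) <= Rabs (x - y)) ->
  (forall x, Rabs (c x) <= 1) -> continuity (trans c f).
Proof.
  intros H Hc Hb. assert (HC := decays_nonneg _ _ H).
  assert (cc : continuity c).
  { apply (continuity_lipschitz _ 1). intros x y. rewrite Rmult_1_l. apply Hc. }
  assert (Hd : forall w, decays (fun x => f x * c (w * x)) C).
  { intros w. apply decays_mult; [exact H|apply continuity_comp_scal, cc|intros; apply Hb]. }
  intros w eps Heps. simpl. unfold Rdist.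
  (* The two truncations to [-M, M], one for each frequency, cost 2 C / M each, hence at most
     [eps / 2] together. The constant [K] below is the Lipschitz constant of the truncated
     transform: length 2 M, height C, and a factor M from the phase. *)
  set (M := 8 * C / eps + 1).
  assert (HM : 1 <= M) by (unfold M; assert (0 <= 8 * C / eps) by (apply Rdiv_le_0_compat; lra); lra).
  assert (HM2 : 4 * C / M <= eps / 2).
  { apply Rle_div_l; [lra|]. unfold M.
    replace (eps / 2 * (8 * C / eps + 1)) with (4 * C + eps / 2) by (field; lra). lra. }
  set (K := 2 * M * C * M).
  assert (HK : 0 <= K) by (unfold K; repeat apply Rmult_le_pos; lra).
  exists (eps / 2 / (K + 1)). split; [apply Rdiv_lt_0_compat; lra|].
  intros v [_ Hv].
  assert (H1 := RIntR_spec _ C M (- M) M (Hd v) ltac:(lra) ltac:(lra) ltac:(lra)).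
  assert (H2 := RIntR_spec _ C M (- M) M (Hd w) ltac:(lra) ltac:(lra) ltac:(lra)).
  fold (trans c f v) in H1. fold (trans c f w) in H2.
  assert (H3 : Rabs (RInt (fun x => f x * c (v * x)) (- M) M - RInt (fun x => f x * c (w * x)) (- M) M)
     <= K * Rabs (v - w)).
  { rewrite <- RInt_Rminus by apply Hd.
    replace (K * Rabs (v - w)) with ((M - - M) * (C * (M * Rabs (v - w)))) by (unfold K; ring).
    apply abs_RInt_le_const; [lra|apply ex_RInt_Rminus; apply Hd|].
    intros t Ht. replace (f t * c (v * t) - f t * c (w * t)) with (f t * (c (v * t) - c (w * t))) by ring.
    rewrite Rabs_mult. apply Rmult_le_compat; try apply Rabs_pos; [apply decays_bounded, H|].
    eapply Rle_trans; [apply Hc|]. replace (v * t - w * t) with (t * (v - w)) by ring.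
    rewrite Rabs_mult. apply Rmult_le_compat_r; [apply Rabs_pos|]. apply Rabs_le; lra. }
  assert (H4 : K * Rabs (v - w) < eps / 2).
  { apply Rle_lt_trans with (K * (eps / 2 / (K + 1))).
    - apply Rmult_le_compat_l; lra.
    - replace (K * (eps / 2 / (K + 1))) with (eps / 2 - eps / 2 / (K + 1)) by (field; lra).
      assert (0 < eps / 2 / (K + 1)) by (apply Rdiv_lt_0_compat; lra). lra. }
  replace (2 * C / M) with (4 * C / M / 2) in H1, H2 by (field; lra).
  apply Rabs_le_between in H1, H2, H3. apply Rabs_def1; lra.
Qed.

Lemma abs_trans_le c f C w :
  decays f C -> continuity c -> (forall x, Rabs (c x) <= 1) -> Rabs (trans c f w) <= 4 * C.
Proof.
  intros H cc Hb.
  assert (Hd : decays (fun x => f x * c (w * x)) C).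
  { apply decays_mult; [exact H|apply continuity_comp_scal, cc|intros; apply Hb]. }
  assert (H1 := RIntR_spec _ C 1 (- 1) 1 Hd ltac:(lra) ltac:(lra) ltac:(lra)).
  fold (trans c f w) in H1.
  assert (H2 : Rabs (RInt (fun x => f x * c (w * x)) (- 1) 1) <= (1 - - 1) * C).
  { apply abs_RInt_le_const; [lra|apply Hd|]. intros t _. apply (decays_bounded _ _ t Hd). }
  apply Rabs_le_between in H1, H2. apply Rabs_le. lra.
Qed.

(* Half the integral over [-N, N] of [(1 - |w| / N) exp (i w x)], i.e. a multiple of the Fejér kernel. *)
Definition fejer (N x : R) : R := RInt (fun w => (1 - w / N) * cos (w * x)) 0 N.

(** This form exhibits the positivity and the O(1 / (N x^2)) decay on which the estimates rely. The
    Dirichlet kernel, which lacks the weight [1 - w / N], has neither. *)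
Lemma fejer_closed_form N x : 0 < N -> x <> 0 -> fejer N x = (1 - cos (N * x)) / (N * x ^ 2).
Proof.
  intros HN Hx. unfold fejer.
  assert (HI : is_RInt (fun w => (1 - w / N) * cos (w * x)) 0 N
    (((1 - N / N) * sin (N * x) / x - cos (N * x) / (N * x ^ 2)) -
     ((1 - 0 / N) * sin (0 * x) / x - cos (0 * x) / (N * x ^ 2)))).
  { apply (is_RInt_derive (V := R_CompleteNormedModule)
      (fun w => (1 - w / N) * sin (w * x) / x - cos (w * x) / (N * x ^ 2))).
    - intros w _. auto_derive; [exact I|]. field. split; lra.
    - intros w _. apply (ex_derive_continuous (V := R_NormedModule)). auto_derive. exact I. }
  rewrite (is_RInt_unique _ _ _ _ HI), Rmult_0_l, sin_0, cos_0. field. split; lra.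
Qed.

Lemma fejer_0 N : 0 < N -> fejer N 0 = N / 2.
Proof.
  intros HN. unfold fejer.
  assert (HI : is_RInt (fun w => (1 - w / N) * cos (w * 0)) 0 N
    ((N - N ^ 2 / (2 * N)) - (0 - 0 ^ 2 / (2 * N)))).
  { apply (is_RInt_derive (V := R_CompleteNormedModule) (fun w => w - w ^ 2 / (2 * N))).
    - intros w _. rewrite Rmult_0_r, cos_0. auto_derive; [exact I|]. field. lra.
    - intros w _. apply (ex_derive_continuous (V := R_NormedModule)). auto_derive. exact I. }
  rewrite (is_RInt_unique _ _ _ _ HI). field. lra.
Qed.

Lemma fejer_scaling N x : 0 < N -> fejer N x = N * fejer 1 (N * x).
Proof.
  intros HN. destruct (Req_dec x 0) as [->|Hx].
  - rewrite Rmult_0_r, !fejer_0 by lra. field.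
  - assert (N * x <> 0) by (apply Rmult_integral_contrapositive_currified; lra).
    rewrite !fejer_closed_form by lra. rewrite !Rmult_1_l. field. split; lra.
Qed.

Lemma fejer_nonneg N x : 0 < N -> 0 <= fejer N x.
Proof.
  intros HN. destruct (Req_dec x 0) as [->|Hx].
  - rewrite fejer_0 by lra. lra.
  - rewrite fejer_closed_form by lra. assert (H := COS_bound (N * x)).
    assert (H2 := pow2_gt_0 x Hx). apply Rdiv_le_0_compat; [lra|]. apply Rmult_lt_0_compat; lra.
Qed.

Lemma fejer_le_inv_sqr N x : 0 < N -> x <> 0 -> fejer N x <= 2 / N / x ^ 2.
Proof.
  intros HN Hx. rewrite fejer_closed_form by lra. assert (H := COS_bound (N * x)).
  assert (H2 := pow2_gt_0 x Hx).
  replace (2 / N / x ^ 2) with (2 / (N * x ^ 2)) by (field; split; lra).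
  apply Rmult_le_compat_r; [|lra].
  left. apply Rinv_0_lt_compat, Rmult_lt_0_compat; lra.
Qed.

Lemma continuity_fejer_weight N x : continuity (fun w => (1 - w / N) * cos (w * x)).
Proof.
  intros w. apply derivable_continuous_pt. apply ex_derive_Reals_0. auto_derive. exact I.
Qed.

Lemma abs_fejer_weight_le N w : 0 < N -> Rabs w <= 2 * N -> Rabs (1 - w / N) <= 3.
Proof.
  intros HN Hw. apply Rabs_le_between in Hw. apply Rabs_le. split.
  - assert (w / N <= 2) by (apply Rle_div_l; lra). lra.
  - assert (-2 <= w / N) by (apply Rle_div_r; lra). lra.
Qed.

Lemma fejer_weight_lipschitz N w x y :
  0 < N -> Rabs w <= 2 * N ->
  Rabs ((1 - w / N) * cos (w * x) - (1 - w / N) * cos (w * y)) <= 6 * N * Rabs (x - y).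
Proof.
  intros HN Hw. rewrite <- Rmult_minus_distr_l, Rabs_mult.
  replace (6 * N * Rabs (x - y)) with (3 * (2 * N * Rabs (x - y))) by ring.
  apply Rmult_le_compat; try apply Rabs_pos; [apply abs_fejer_weight_le; assumption|].
  eapply Rle_trans; [apply cos_lipschitz|].
  rewrite <- Rmult_minus_distr_l, Rabs_mult.
  apply Rmult_le_compat_r; [apply Rabs_pos|exact Hw].
Qed.

Lemma continuity_fejer N : 0 < N -> continuity (fejer N).
Proof.
  intros HN. apply (continuity_lipschitz _ (N * (6 * N))). intros x y. unfold fejer.
  rewrite <- RInt_Rminus by (apply ex_RInt_continuity, continuity_fejer_weight).
  replace (N * (6 * N) * Rabs (x - y)) with ((N - 0) * (6 * N * Rabs (x - y))) by ring.
  apply abs_RInt_le_const; [lra| |].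
  - apply ex_RInt_Rminus; apply ex_RInt_continuity, continuity_fejer_weight.
  - intros w Hw. apply fejer_weight_lipschitz; [exact HN|]. apply Rabs_le; lra.
Qed.

Lemma fejer_1_le_1 x : fejer 1 x <= 1.
Proof.
  unfold fejer. eapply Rle_trans; [apply Rle_abs|].
  apply Rle_trans with ((1 - 0) * 1); [|lra].
  apply abs_RInt_le_const; [lra|apply ex_RInt_continuity, continuity_fejer_weight|].
  intros w Hw. rewrite Rabs_mult. apply Rle_trans with (1 * 1); [|lra].
  apply Rmult_le_compat; try apply Rabs_pos; [|apply abs_cos_le_1].
  unfold Rdiv. rewrite Rinv_1. apply Rabs_le; lra.
Qed.

Lemma decays_fejer_1 : decays (fejer 1) 4.
Proof.
  split.
  - intros a b. apply ex_RInt_continuity, continuity_fejer; lra.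
  - intros t. assert (H0 := fejer_nonneg 1 t ltac:(lra)). rewrite Rabs_right by lra.
    assert (Ht := pow2_ge_0 t).
    destruct (Rle_dec (t ^ 2) 1) as [H|H].
    + eapply Rle_trans; [apply fejer_1_le_1|]. apply Rle_div_r; lra.
    + assert (Hn : t <> 0) by (intros ->; apply H; simpl; lra).
      eapply Rle_trans; [apply fejer_le_inv_sqr; lra|].
      apply Rle_div_l; [lra|]. replace (4 / (1 + t ^ 2) * t ^ 2) with (4 * t ^ 2 / (1 + t ^ 2)) by (field; lra).
      replace (2 / 1) with 2 by field. apply (Rle_div_r 2); lra.
Qed.

(** The number is PI; its positivity is what allows the inversion formula to divide by it. *)
Definition fejer_mass : R := RIntR (fejer 1).

(** For |w x| <= 1 the Taylor bound cos y >= 1 - y^2 / 2 gives cos (w x) >= 1/2. The kernel is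
    therefore at least 1/4 on [-1, 1], which contributes mass 1/2. *)
Lemma fejer_mass_pos : 0 < fejer_mass.
Proof.
  apply Rlt_le_trans with (RInt (fejer 1) (- 1) 1).
  - apply Rlt_le_trans with (1 / 2); [lra|].
    assert (E : RInt (fun _ => 1 / 4) (- 1) 1 = 1 / 2 :> R) by (rewrite RInt_Rconst; field).
    rewrite <- E.
    apply RInt_le; [lra|apply ex_RInt_const|apply decays_fejer_1|].
    intros x Hx. unfold fejer.
    assert (HI : is_RInt (fun w => (1 - w / 1) * (1 / 2)) 0 1 ((1 / 2 - 1 ^ 2 / 4) - (0 / 2 - 0 ^ 2 / 4))).
    { apply (is_RInt_derive (V := R_CompleteNormedModule) (fun w => w / 2 - w ^ 2 / 4)).
      - intros w _. auto_derive; [exact I|]. field.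
      - intros w _. apply (ex_derive_continuous (V := R_NormedModule)). auto_derive. exact I. }
    replace (1 / 4) with ((1 / 2 - 1 ^ 2 / 4) - (0 / 2 - 0 ^ 2 / 4)) by field.
    rewrite <- (is_RInt_unique _ _ _ _ HI).
    apply RInt_le; [lra|eexists; exact HI|apply ex_RInt_continuity, continuity_fejer_weight|].
    intros w Hw. apply Rmult_le_compat_l; [unfold Rdiv; rewrite Rinv_1; lra|].
    assert (Hwx : -1 <= w * x <= 1) by nra.
    destruct (pre_cos_bound (w * x) 0 ltac:(lra) ltac:(lra)) as [Hc _].
    unfold cos_approx, cos_term in Hc. simpl in Hc.
    eapply Rle_trans; [|exact Hc]. nra.
  - apply RInt_le_RIntR with 4; [apply decays_fejer_1|lra|].
    intros x. apply fejer_nonneg; lra.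
Qed.

Lemma RInt_fejer_scaling N d : 0 < N ->
  RInt (fejer N) (- d) d = RInt (fejer 1) (- (N * d)) (N * d) :> R.
Proof.
  intros HN.
  assert (ex := proj1 decays_fejer_1).
  assert (H := RInt_comp_lin (fejer 1) N 0 (- d) d (ex _ _)).
  replace (N * - d + 0) with (- (N * d)) in H by ring.
  replace (N * d + 0) with (N * d) in H by ring.
  rewrite <- H. apply RInt_Rext. intros x _. rewrite Rplus_0_r. apply fejer_scaling, HN.
Qed.

Lemma RInt_fejer_mass N d : 0 < N -> 0 < d ->
  fejer_mass - 8 / (N * d) <= RInt (fejer N) (- d) d <= fejer_mass.
Proof.
  intros HN Hd. rewrite RInt_fejer_scaling by exact HN.
  assert (HNd : 0 < N * d) by (apply Rmult_lt_0_compat; assumption). split.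
  - assert (H := RIntR_spec _ 4 (N * d) (- (N * d)) (N * d) decays_fejer_1 HNd ltac:(lra) ltac:(lra)).
    fold fejer_mass in H. replace (2 * 4 / (N * d)) with (8 / (N * d)) in H by (field; lra).
    apply Rabs_le_between in H. lra.
  - apply RInt_le_RIntR with 4; [apply decays_fejer_1|lra|].
    intros x. apply fejer_nonneg; lra.
Qed.

(** The usual approximate-identity estimate, with a fixed oscillation bound [e] in place of
    continuity at 0. The 12 collects 2 + 2 from the tails beyond [d] and 8 from the kernel mass
    missing on [-d, d]. *)
Lemma fejer_mean_approx (f : R -> R) (C N d e T : R) :
  decays f C -> 0 < N -> 0 < d < T ->
  (forall x, Rabs x < d -> Rabs (f x - f 0) <= e) ->
  Rabs (RInt (fun x => f x * fejer N x) (- T) T - fejer_mass * f 0) <=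
    fejer_mass * e + 12 * C / (N * d).
Proof.
  intros H HN HdT He. assert (HC := decays_nonneg _ _ H).
  assert (HNd : 0 < N * d) by (apply Rmult_lt_0_compat; lra).
  assert (He0 : 0 <= e).
  { specialize (He 0). rewrite Rabs_R0 in He. eapply Rle_trans; [apply Rabs_pos|apply He; lra]. }
  assert (ex : forall a b, ex_RInt (fun x => f x * fejer N x) a b).
  { intros a b. apply ex_RInt_mult_continuity; [apply H|apply continuity_fejer, HN]. }
  assert (exk : forall a b, ex_RInt (fejer N) a b).
  { intros a b. apply ex_RInt_continuity, continuity_fejer, HN. }
  assert (Htail : forall t, t <> 0 -> Rabs (f t * fejer N t) <= (2 * C / N) / t ^ 2).
  { intros t Ht. rewrite Rabs_mult.
    replace (2 * C / N / t ^ 2) with (C * (2 / N / t ^ 2)) by (field; lra).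
    apply Rmult_le_compat; try apply Rabs_pos; [apply decays_bounded, H|].
    rewrite Rabs_right by (apply Rle_ge, fejer_nonneg, HN). apply fejer_le_inv_sqr; assumption. }
  assert (HC' : 0 <= 2 * C / N) by (apply Rdiv_le_0_compat; lra).
  rewrite (RInt_Chasles_R _ (- T) (- d) T), (RInt_Chasles_R _ (- d) d T) by apply ex.
  assert (H1 : Rabs (RInt (fun x => f x * fejer N x) (- T) (- d)) <= 2 * C / N / d).
  { apply abs_RInt_inv_sqr_left; try lra; [apply ex|]. intros t Ht. apply Htail; lra. }
  assert (H2 : Rabs (RInt (fun x => f x * fejer N x) d T) <= 2 * C / N / d).
  { apply abs_RInt_inv_sqr_right; try lra; [apply ex|]. intros t Ht. apply Htail; lra. }
  assert (Hm := RInt_fejer_mass N d HN ltac:(lra)).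
  assert (H3 : Rabs (RInt (fun x => f x * fejer N x) (- d) d - f 0 * RInt (fejer N) (- d) d)
    <= e * RInt (fejer N) (- d) d).
  { rewrite <- !RInt_Rscal by apply exk.
    rewrite <- RInt_Rminus; [|apply ex|apply ex_RInt_Rscal, exk].
    eapply Rle_trans; [apply abs_RInt_le; [lra|]|].
    { apply ex_RInt_Rminus; [apply ex|apply ex_RInt_Rscal, exk]. }
    apply RInt_le; [lra| |apply ex_RInt_Rscal, exk|].
    { apply (ex_RInt_norm (fun x => f x * fejer N x - f 0 * fejer N x)).
      apply ex_RInt_Rminus; [apply ex|apply ex_RInt_Rscal, exk]. }
    intros x Hx. rewrite <- Rmult_minus_distr_r, Rabs_mult.
    assert (Hk := fejer_nonneg N x HN).
    rewrite (Rabs_right (fejer N x)) by lra.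
    apply Rmult_le_compat_r; [exact Hk|]. apply He. apply Rabs_def1; lra. }
  assert (H4 : Rabs (f 0 * RInt (fejer N) (- d) d - fejer_mass * f 0) <= C * (8 / (N * d))).
  { replace (f 0 * RInt (fejer N) (- d) d - fejer_mass * f 0)
      with (f 0 * (RInt (fejer N) (- d) d - fejer_mass)) by ring.
    rewrite Rabs_mult. apply Rmult_le_compat; try apply Rabs_pos; [apply (decays_bounded _ _ _ H)|].
    apply Rabs_le. assert (0 < 8 / (N * d)) by (apply Rdiv_lt_0_compat; lra). lra. }
  assert (H5 : e * RInt (fejer N) (- d) d <= e * fejer_mass) by (apply Rmult_le_compat_l; lra).
  replace (12 * C / (N * d)) with (2 * C / N / d + 2 * C / N / d + C * (8 / (N * d)))
    by (field; lra).
  apply Rabs_le_between in H1, H2, H3, H4. apply Rabs_le. lra.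
Qed.

(** [RInt_swap] exchanges proper integrals, so [x] is first confined to [-T, T]. Replacing the
    truncated transform by [trans cos f] then costs 2 C / T at each frequency in [0, N]. *)
Lemma fejer_mean_trans (f : R -> R) (C N T : R) :
  decays f C -> 0 < N -> 0 < T ->
  Rabs (RInt (fun x => f x * fejer N x) (- T) T - RInt (fun w => (1 - w / N) * trans cos f w) 0 N)
    <= 2 * C * N / T.
Proof.
  intros H HN HT. assert (HC := decays_nonneg _ _ H).
  (* For |w| <= 2 N the weight is at most 3 in modulus. The Lipschitz constant in [w] is 1 / N from
     the weight plus 3 T from the phase; the one in [x] is 3 times 2 N. *)
  destruct (RInt_swap f (fun w x => (1 - w / N) * cos (w * x)) (- T) T N (2 * N)
    (1 / N + 3 * T) (6 * N)) as [Hex Heq].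
  - lra.
  - lra.
  - apply H.
  - assert (0 < 1 / N) by (apply Rdiv_lt_0_compat; lra). lra.
  - intros x. apply continuity_fejer_weight.
  - intros w. apply (continuity_mult (fun _ => 1 - w / N)).
    + apply continuity_const. intros ? ?; reflexivity.
    + apply continuity_comp_scal, continuity_cos.
  - intros w w' x Hw Hw' Hx.
    replace ((1 - w / N) * cos (w * x) - (1 - w' / N) * cos (w' * x)) with
      ((w' - w) / N * cos (w * x) + (1 - w' / N) * (cos (w * x) - cos (w' * x))) by (field; lra).
    rewrite Rmult_plus_distr_r.
    eapply Rle_trans; [apply Rabs_triang|]. apply Rplus_le_compat; rewrite Rabs_mult.
    + rewrite <- (Rmult_1_r (1 / N * Rabs (w - w'))).
      apply Rmult_le_compat; try apply Rabs_pos; [|apply abs_cos_le_1].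
      unfold Rdiv. rewrite Rabs_mult, Rabs_minus_sym, (Rabs_right (/ N)).
      * right; ring.
      * apply Rle_ge. left. apply Rinv_0_lt_compat, HN.
    + rewrite Rmult_assoc. apply Rmult_le_compat; try apply Rabs_pos.
      * apply abs_fejer_weight_le; assumption.
      * eapply Rle_trans; [apply cos_lipschitz|].
        rewrite <- Rmult_minus_distr_r, Rabs_mult, Rmult_comm.
        apply Rmult_le_compat_r; [apply Rabs_pos|]. apply Rabs_le; lra.
  - intros w x y Hw. apply fejer_weight_lipschitz; assumption.
  - change (fun x => f x * RInt (fun w => (1 - w / N) * cos (w * x)) 0 N)
      with (fun x => f x * fejer N x) in Heq.
    rewrite <- Heq.
    assert (Hex2 : ex_RInt (fun w => (1 - w / N) * trans cos f w) 0 N).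
    { apply ex_RInt_continuity. apply continuity_mult.
      - intros w. apply derivable_continuous_pt. apply ex_derive_Reals_0. auto_derive. exact I.
      - apply trans_continuity with C; [exact H|apply cos_lipschitz|apply abs_cos_le_1]. }
    rewrite <- RInt_Rminus by assumption.
    replace (2 * C * N / T) with ((N - 0) * (1 * (2 * C / T))) by (field; lra).
    apply abs_RInt_le_const; [lra|apply ex_RInt_Rminus; assumption|].
    intros w Hw.
    assert (Hd : decays (fun x => f x * cos (w * x)) C).
    { apply decays_mult; [exact H|apply continuity_comp_scal, continuity_cos|intros; apply abs_cos_le_1]. }
    rewrite (RInt_Rext (fun x => f x * ((1 - w / N) * cos (w * x)))
      (fun x => (1 - w / N) * (f x * cos (w * x)))) by (intros; ring).
    rewrite RInt_Rscal by apply Hd.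
    rewrite <- Rmult_minus_distr_l, Rabs_mult.
    apply Rmult_le_compat; try apply Rabs_pos.
    + assert (0 <= w / N) by (apply Rdiv_le_0_compat; lra).
      assert (w / N <= 1) by (apply Rle_div_l; lra). apply Rabs_le; lra.
    + apply RIntR_spec; try lra. exact Hd.
Qed.

(** Since the transform vanishes beyond [b], only weights with w <= b survive. They differ from 1 by
    at most b / N, so the Fejér mean tends to the plain integral. *)
Lemma fourier_inversion_at_0 (f : R -> R) (C b d e : R) :
  decays f C -> 0 < b -> (forall w, b < w -> trans cos f w = 0) ->
  0 < d -> (forall x, Rabs x < d -> Rabs (f x - f 0) <= e) ->
  Rabs (RInt (trans cos f) 0 b - fejer_mass * f 0) <= fejer_mass * e.
Proof.
  intros H Hb Hvan Hd He. assert (HC := decays_nonneg _ _ H).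
  apply (le_of_le_add_div _ _ (4 * C * b ^ 2 + 2 * C + 12 * C / d) b). intros N HbN HN.
  (* Quadratic growth of [T] brings the truncation error 2 C N / T down to 2 C / N; the summand [d]
     secures d < T. *)
  set (T := N ^ 2 + d).
  assert (HN2 : 0 < N ^ 2) by (apply pow_lt, HN).
  assert (H1 := fejer_mean_approx f C N d e T H HN ltac:(unfold T; lra) He).
  assert (H2 := fejer_mean_trans f C N T H HN ltac:(unfold T; lra)).
  assert (HNT : 2 * C * N / T <= 2 * C / N).
  { unfold T. apply Rle_div_l; [lra|].
    replace (2 * C / N * (N ^ 2 + d)) with (2 * C * N + 2 * C / N * d) by (field; lra).
    assert (0 <= 2 * C / N * d) by (apply Rmult_le_pos; [apply Rdiv_le_0_compat; lra|lra]). lra. }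
  assert (Ht : continuity (trans cos f)).
  { apply trans_continuity with C; [exact H|apply cos_lipschitz|apply abs_cos_le_1]. }
  assert (ex : forall p q, ex_RInt (fun w => (1 - w / N) * trans cos f w) p q).
  { intros p q. apply ex_RInt_continuity. apply continuity_mult; [|exact Ht].
    intros w. apply derivable_continuous_pt. apply ex_derive_Reals_0. auto_derive. exact I. }
  rewrite (RInt_Chasles_R _ 0 b N) in H2 by apply ex.
  rewrite (RInt_Rext (fun w => (1 - w / N) * trans cos f w) (fun _ => 0) b N), RInt_Rconst in H2.
  2:{ intros w. rewrite Rmin_left, Rmax_right by lra. intros Hw. rewrite Hvan by lra. ring. }
  assert (H3 : Rabs (RInt (fun w => (1 - w / N) * trans cos f w) 0 b - RInt (trans cos f) 0 b)
     <= 4 * C * b ^ 2 / N).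
  { rewrite <- RInt_Rminus; [|apply ex|apply ex_RInt_continuity, Ht].
    replace (4 * C * b ^ 2 / N) with ((b - 0) * (b / N * (4 * C))) by (field; lra).
    apply abs_RInt_le_const; [lra|apply ex_RInt_Rminus; [apply ex|apply ex_RInt_continuity, Ht]|].
    intros w Hw.
    replace ((1 - w / N) * trans cos f w - trans cos f w) with (- (w / N) * trans cos f w) by ring.
    rewrite Rabs_mult. apply Rmult_le_compat; try apply Rabs_pos.
    - rewrite Rabs_Ropp, Rabs_right.
      + apply Rmult_le_compat_r; [left; apply Rinv_0_lt_compat, HN|lra].
      + apply Rle_ge, Rdiv_le_0_compat; lra.
    - apply abs_trans_le; [exact H|apply continuity_cos|apply abs_cos_le_1]. }
  replace ((4 * C * b ^ 2 + 2 * C + 12 * C / d) / N) with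
    (4 * C * b ^ 2 / N + 2 * C / N + 12 * C / (N * d)) by (field; lra).
  apply Rabs_le_between in H1, H2, H3. apply Rabs_le. lra.
Qed.

(** * Points of small oscillation of a Riemann integrable function *)

Lemma Int_SF_piece (v : R) (lf l : list R) :
  length l = S (length lf) -> ordered_Rlist l ->
  Int_SF lf l < v * (pos_Rl l (pred (length l)) - pos_Rl l 0) ->
  exists i, (i < pred (length l))%nat /\ pos_Rl l i < pos_Rl l (S i) /\ pos_Rl lf i < v.
Proof.
  revert l. induction lf as [|y lf IH]; intros l Hl Ho Hlt.
  - destruct l as [|x [|x' l]]; simpl in *; try discriminate. lra.
  - destruct l as [|x [|x' l]]; simpl in Hl; try discriminate.
    simpl in Hlt.
    assert (Hx : x <= x') by (apply (Ho 0%nat); simpl; lia).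
    destruct (Rlt_dec (y * (x' - x)) (v * (x' - x))) as [H|H].
    + exists 0%nat. simpl. split; [lia|].
      assert (Hlt' : x < x').
      { destruct Hx as [Hx|E]; [exact Hx|]. rewrite E, Rminus_diag, !Rmult_0_r in H. lra. }
      split; [exact Hlt'|]. apply Rmult_lt_reg_r with (x' - x); lra.
    + destruct (IH (cons x' l)) as [i [H1 [H2 H3]]].
      * simpl. lia.
      * intros i Hi. apply (Ho (S i)). simpl in *. lia.
      * simpl in Hlt |- *. lra.
      * exists (S i). simpl in *. split; [lia|]. split; assumption.
Qed.

(** Otherwise every nondegenerate piece would contribute at least [v] times its length to the
    integral. *)
Lemma StepFun_piece (a b v : R) (F : StepFun a b) :
  a < b -> RiemannInt_SF F < v * (b - a) ->
  exists c d y, a <= c /\ c < d /\ d <= b /\ y < v /\ forall x, c < x < d -> F x = y.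
Proof.
  intros Hab HF. unfold RiemannInt_SF in HF.
  destruct (Rle_dec a b) as [_|N]; [|lra].
  unfold subdivision_val, subdivision in HF.
  destruct F as [F [l [lf Hl]]]. simpl in *.
  destruct Hl as [Ho [H0 [H1 [Hlen Hc]]]].
  rewrite Rmin_left in H0 by lra. rewrite Rmax_right in H1 by lra.
  destruct (Int_SF_piece v lf l Hlen Ho) as [i [Hi [Hlt Hv]]].
  { rewrite H0, H1. exact HF. }
  exists (pos_Rl l i), (pos_Rl l (S i)), (pos_Rl lf i).
  split; [|split; [exact Hlt|split; [|split; [exact Hv|]]]].
  - rewrite <- H0. apply RList_P5; [exact Ho|]. apply RList_P3. exists i. split; [reflexivity|lia].
  - rewrite <- H1. apply RList_P7; [exact Ho|]. apply RList_P3. exists (S i). split; [reflexivity|lia].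
  - intros x Hx. apply (Hc i Hi x Hx).
Qed.

(** The error function [psi] has mean below e / 2, so it is below e / 2 on some interval. Inside it
    there is an interval on which [phi] is constant, and on that one [f] stays within e / 2 of a
    constant. The point [u] is its midpoint. *)
Lemma ex_RInt_small_oscillation (f : R -> R) (a b e : R) :
  ex_RInt f a b -> a < b -> 0 < e ->
  exists u d, a < u < b /\ 0 < d /\ forall x, Rabs (x - u) < d -> Rabs (f x - f u) <= e.
Proof.
  intros Hf Hab He.
  assert (Heta : 0 < e / 2 * (b - a)) by nra.
  destruct (ex_RInt_Reals_0 f a b Hf (mkposreal _ Heta)) as [phi [psi [H1 H2]]]. simpl in H2.
  rewrite Rmin_left, Rmax_right in H1 by lra.
  destruct (StepFun_piece a b (e / 2) psi Hab) as [c [d [y [Hac [Hcd [Hdb [Hy Hpsi]]]]]]].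
  { eapply Rle_lt_trans; [apply Rle_abs|exact H2]. }
  assert (S1 := StepFun_P45 (StepFun_P44 (pre phi) (c := d) ltac:(lra)) (c := c) ltac:(lra)).
  set (phi' := mkStepFun S1).
  (* Every step function has mean below its mean plus 1: this call serves only to extract an
     interval on which [phi] is constant. *)
  destruct (StepFun_piece c d (RiemannInt_SF phi' / (d - c) + 1) phi' Hcd)
    as [c' [d' [z [Hcc [Hcd' [Hdd [_ Hphi]]]]]]].
  { replace ((RiemannInt_SF phi' / (d - c) + 1) * (d - c)) with
      (RiemannInt_SF phi' + (d - c)) by (field; lra). lra. }
  simpl in Hphi.
  exists ((c' + d') / 2), ((d' - c') / 2). split; [lra|]. split; [lra|].
  assert (Hb : forall x, c' < x < d' -> Rabs (f x - z) <= e / 2).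
  { intros x Hx. specialize (H1 x ltac:(lra)). rewrite Hphi in H1 by lra.
    rewrite Hpsi in H1 by lra. lra. }
  intros x Hx. apply Rabs_def2 in Hx.
  assert (B1 := Hb x ltac:(lra)). assert (B2 := Hb ((c' + d') / 2) ltac:(lra)).
  apply Rabs_le_between in B1, B2. apply Rabs_le. lra.
Qed.

Lemma RInt_shift (f : R -> R) (u p q : R) :
  (forall a b, ex_RInt f a b) ->
  ex_RInt (fun x => f (u + x)) p q /\
  RInt (fun x => f (u + x)) p q = RInt f (u + p) (u + q) :> R.
Proof.
  intros ex.
  assert (H1 := ex_RInt_comp_lin f 1 u p q (ex _ _)).
  assert (H2 := RInt_comp_lin f 1 u p q (ex _ _)).
  assert (E : forall x, 1 * f (1 * x + u) = f (u + x)).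
  { intros x. rewrite Rmult_1_l. f_equal. ring. }
  split.
  - apply ex_RInt_ext with (2 := H1). intros x _. apply E.
  - rewrite <- (RInt_Rext _ _ p q (fun x _ => E x)).
    rewrite (Rplus_comm u p), (Rplus_comm u q).
    rewrite <- (Rmult_1_l p) at 2. rewrite <- (Rmult_1_l q) at 2. exact H2.
Qed.

Lemma decays_shift f C u : decays f C -> decays (fun x => f (u + x)) (2 * (1 + u ^ 2) * C).
Proof.
  intros H. assert (HC := decays_nonneg _ _ H). destruct H as [ex Hb]. split.
  - intros a b. apply RInt_shift, ex.
  - intros t. eapply Rle_trans; [apply Hb|].
    assert (H1 := pow2_ge_0 t). assert (H2 := pow2_ge_0 (u + t)).
    assert (H3 : 1 + t ^ 2 <= 2 * (1 + u ^ 2) * (1 + (u + t) ^ 2)).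
    { assert (H4 := pow2_ge_0 (t + 2 * u)). assert (H5 := pow2_ge_0 u).
      assert (0 <= u ^ 2 * (u + t) ^ 2) by (apply Rmult_le_pos; assumption). nra. }
    apply Rle_div_l; [lra|].
    replace (2 * (1 + u ^ 2) * C / (1 + t ^ 2) * (1 + (u + t) ^ 2)) with
      (C * (2 * (1 + u ^ 2) * (1 + (u + t) ^ 2) / (1 + t ^ 2))) by (field; lra).
    rewrite <- (Rmult_1_r C) at 1. apply Rmult_le_compat_l; [exact HC|].
    apply Rle_div_r; lra.
Qed.

Lemma decays_mult_cos f C w : decays f C -> decays (fun x => f x * cos (w * x)) C.
Proof.
  intros H. apply decays_mult; [exact H|apply continuity_comp_scal, continuity_cos|].
  intros; apply abs_cos_le_1.
Qed.

Lemma decays_mult_sin f C w : decays f C -> decays (fun x => f x * sin (w * x)) C.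
Proof.
  intros H. apply decays_mult; [exact H|apply continuity_comp_scal, continuity_sin|].
  intros; apply abs_sin_le_1.
Qed.

Lemma trans_cos_shift f C u w :
  decays f C ->
  trans cos (fun x => f (u + x)) w = trans cos f w * cos (w * u) + trans sin f w * sin (w * u).
Proof.
  intros H. assert (HC := decays_nonneg _ _ H).
  assert (Hc := decays_mult_cos f C w H). assert (Hs := decays_mult_sin f C w H).
  unfold trans at 1.
  apply (RIntR_unique _ (2 * (1 + u ^ 2) * C) _ (4 * C)).
  { apply decays_mult_cos, decays_shift, H. }
  (* Enlarging the window by |u| makes its translate by [u] still contain [-M, M]. *)
  intros M HM. exists (- (M + Rabs u)), (M + Rabs u).
  assert (Hu := Rabs_pos u). assert (Hu' := Rle_abs u). assert (Hu'' := Rle_abs (- u)).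
  rewrite Rabs_Ropp in Hu''.
  split; [lra|]. split; [lra|].
  set (p := - (M + Rabs u)). set (q := M + Rabs u).
  set (g := fun s => cos (w * u) * (f s * cos (w * s)) + sin (w * u) * (f s * sin (w * s))).
  assert (exg : forall a b, ex_RInt g a b).
  { intros a b. apply ex_RInt_Rplus; apply ex_RInt_Rscal; [apply Hc|apply Hs]. }
  rewrite (RInt_Rext (fun x => f (u + x) * cos (w * x)) (fun x => g (u + x))).
  2:{ intros x _. unfold g. replace (w * x) with (w * (u + x) - w * u) by ring. rewrite cos_minus. ring. }
  rewrite (proj2 (RInt_shift g u p q exg)). unfold g.
  rewrite RInt_Rplus; [|apply ex_RInt_Rscal, Hc|apply ex_RInt_Rscal, Hs].
  rewrite !RInt_Rscal; [|apply Hs|apply Hc].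
  assert (B1 := RIntR_spec _ C M (u + p) (u + q) Hc ltac:(lra) ltac:(unfold p; lra) ltac:(unfold q; lra)).
  assert (B2 := RIntR_spec _ C M (u + p) (u + q) Hs ltac:(lra) ltac:(unfold p; lra) ltac:(unfold q; lra)).
  fold (trans cos f w) in B1. fold (trans sin f w) in B2.
  set (I1 := RInt (fun s => f s * cos (w * s)) (u + p) (u + q)) in *.
  set (I2 := RInt (fun s => f s * sin (w * s)) (u + p) (u + q)) in *.
  replace (cos (w * u) * I1 + sin (w * u) * I2 -
     (trans cos f w * cos (w * u) + trans sin f w * sin (w * u))) with
    (cos (w * u) * (I1 - trans cos f w) + sin (w * u) * (I2 - trans sin f w)) by ring.
  eapply Rle_trans; [apply Rabs_triang|]. rewrite !Rabs_mult.
  replace (4 * C / M) with (1 * (2 * C / M) + 1 * (2 * C / M)) by (field; lra).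
  apply Rplus_le_compat; apply Rmult_le_compat; try apply Rabs_pos; try assumption.
  - apply abs_cos_le_1.
  - apply abs_sin_le_1.
Qed.

(** The inverse Fourier integral over [-b, b], folded onto [0, b] by the parity of the two
    transforms; [/ fejer_mass] is the classical factor 1 / PI. It makes sense whether or not it
    reproduces [f], and will be analytic in [u]. *)
Definition band_synthesis (f : R -> R) (b u : R) : R :=
  / fejer_mass * RInt (fun w => trans cos f w * cos (w * u) + trans sin f w * sin (w * u)) 0 b.

Lemma fourier_inversion (f : R -> R) (C b u d e : R) :
  decays f C -> 0 < b ->
  (forall w, b < w -> trans cos f w = 0 /\ trans sin f w = 0) ->
  0 < d -> (forall x, Rabs (x - u) < d -> Rabs (f x - f u) <= e) ->
  Rabs (band_synthesis f b u - f u) <= e.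
Proof.
  intros H Hb Hvan Hd He.
  assert (Hm := fejer_mass_pos).
  assert (H1 := fourier_inversion_at_0 (fun x => f (u + x)) _ b d e (decays_shift f C u H) Hb).
  rewrite (RInt_Rext (trans cos (fun x => f (u + x)))
    (fun w => trans cos f w * cos (w * u) + trans sin f w * sin (w * u))) in H1
    by (intros w _; apply trans_cos_shift with C, H).
  unfold band_synthesis. set (I := RInt _ 0 b) in *.
  rewrite Rplus_0_r in H1.
  assert (H2 : Rabs (I - fejer_mass * f u) <= fejer_mass * e).
  { apply H1; [|exact Hd|].
    - intros w Hw. rewrite (trans_cos_shift f C) by exact H.
      destruct (Hvan w Hw) as [-> ->]. ring.
    - intros x Hx. apply He. replace (u + x - u) with x by ring. exact Hx. }
  replace (/ fejer_mass * I - f u) with (/ fejer_mass * (I - fejer_mass * f u)) by (field; lra).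
  rewrite Rabs_mult, (Rabs_right (/ fejer_mass)).
  - apply Rmult_le_reg_l with fejer_mass; [exact Hm|].
    rewrite <- Rmult_assoc, Rinv_r, Rmult_1_l by lra. exact H2.
  - left. apply Rinv_0_lt_compat, Hm.
Qed.

Lemma improper_integral_0_RIntR f C : decays f C -> improper_integral f 0 -> RIntR f = 0.
Proof.
  intros H [_ Hi]. apply (RIntR_unique f C 0 1 H). intros M HM.
  destruct (Hi (1 / M)) as [M' HM']; [apply Rdiv_lt_0_compat; lra|].
  set (T := Rmax M M'). assert (T1 : M <= T) by apply Rmax_l. assert (T2 : M' <= T) by apply Rmax_r.
  exists (- T), T. split; [lra|]. split; [exact T1|].
  assert (pr := ex_RInt_Reals_0 f (- T) T (proj1 H _ _)).
  rewrite (RInt_Reals f (- T) T pr). left. apply HM'; lra.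
Qed.

(** [bandlimited_some] asserts integrability only of the modulated functions. Multiplying them once
    more by cosine and sine and adding recovers the function itself, as cos^2 + sin^2 = 1. *)
Lemma fourier_vanishes_ex_RInt f xi a b : fourier_vanishes_at f xi -> ex_RInt f a b.
Proof.
  intros [[H1 _] [H2 _]].
  destruct (H1 a b) as [R1]. destruct (H2 a b) as [R2].
  apply ex_RInt_Reals_1 in R1, R2.
  apply ex_RInt_ext with (fun t => f t * cos (2 * PI * xi * t) * cos (2 * PI * xi * t) +
    f t * sin (2 * PI * xi * t) * sin (2 * PI * xi * t)).
  - intros t _. assert (E := sin2_cos2 (2 * PI * xi * t)). unfold Rsqr in E.
    set (c := cos (2 * PI * xi * t)) in *. set (s := sin (2 * PI * xi * t)) in *.
    change (f t * c * c + f t * s * s = f t :> R).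
    replace (f t * c * c + f t * s * s) with (f t * (s * s + c * c)) by ring. rewrite E. ring.
  - apply ex_RInt_Rplus.
    + apply (ex_RInt_mult_continuity (fun t => f t * cos (2 * PI * xi * t))); [exact R1|].
      apply (continuity_comp_scal cos (2 * PI * xi)), continuity_cos.
    + apply (ex_RInt_mult_continuity (fun t => f t * sin (2 * PI * xi * t))); [exact R2|].
      apply (continuity_comp_scal sin (2 * PI * xi)), continuity_sin.
Qed.

Lemma fourier_vanishes_trans f C xi :
  decays f C -> fourier_vanishes_at f xi ->
  trans cos f (2 * PI * xi) = 0 /\ trans sin f (2 * PI * xi) = 0.
Proof.
  intros H [H1 H2]. split.
  - apply (improper_integral_0_RIntR _ C) with (2 := H1). apply decays_mult_cos, H.
  - apply (improper_integral_0_RIntR _ C) with (2 := H2). apply decays_mult_sin, H.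
Qed.

(** * Estimates for the complex modulus *)

Lemma Cmod_le_sum (z : C) : Cmod z <= Rabs (fst z) + Rabs (snd z).
Proof.
  destruct z as [x y]. unfold Cmod. simpl fst. simpl snd.
  assert (Hx := Rabs_pos x). assert (Hy := Rabs_pos y).
  apply Rsqr_incr_0_var; [|lra]. rewrite Rsqr_sqrt by nra.
  unfold Rsqr. rewrite <- (pow2_abs x), <- (pow2_abs y). nra.
Qed.

Lemma abs_fst_le_Cmod (z : C) : Rabs (fst z) <= Cmod z.
Proof. eapply Rle_trans; [apply Rmax_l|apply Rmax_Cmod]. Qed.

Lemma abs_snd_le_Cmod (z : C) : Rabs (snd z) <= Cmod z.
Proof. eapply Rle_trans; [apply Rmax_r|apply Rmax_Cmod]. Qed.

Lemma Cmod_sub_comm (z w : C) : Cmod (z - w) = Cmod (w - z).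
Proof. rewrite <- Cmod_opp. f_equal. ring. Qed.

Lemma Cmod_plus_le (z w : C) a b : Cmod z <= a -> Cmod w <= b -> Cmod (z + w) <= a + b.
Proof. intros Hz Hw. eapply Rle_trans; [apply Cmod_triangle|]. lra. Qed.

Lemma Cmod_minus_le (z w : C) a b : Cmod z <= a -> Cmod w <= b -> Cmod (z - w) <= a + b.
Proof. intros Hz Hw. apply Cmod_plus_le; [exact Hz|]. rewrite Cmod_opp. exact Hw. Qed.

Lemma Cmod_mult_le (z w : C) a b : Cmod z <= a -> Cmod w <= b -> Cmod (z * w) <= a * b.
Proof. intros Hz Hw. rewrite Cmod_mult. apply Rmult_le_compat; try assumption; apply Cmod_ge_0. Qed.

(** * Entire functions *)

Definition loclip (F : C -> C) : Prop :=
  forall M, exists L, 0 <= L /\ forall z w, Cmod z <= M -> Cmod w <= M ->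
    Cmod (F w - F z) <= L * Cmod (w - z).

(* Complex differentiability with a locally uniform quadratic remainder. This holds for every
   entire function, and is stable under sums, products, compositions and parametric integrals
   without any appeal to compactness. *)
Definition hasderiv (F F' : C -> C) : Prop :=
  forall M, exists B, 0 <= B /\ forall z w, Cmod z <= M -> Cmod w <= M ->
    Cmod (F w - F z - (w - z) * F' z) <= B * Cmod (w - z) ^ 2.

(** The index is a budget of derivatives: each divided difference spends one, and uniqueness of
    continuation as well as the decay argument require one to be left. *)
Fixpoint smooth (n : nat) (F : C -> C) : Prop :=
  match n with
  | O => loclip F
  | S m => exists F', hasderiv F F' /\ smooth m F'
  end.

Lemma loclip_bounded F : loclip F ->
  forall M, exists K, 0 <= K /\ forall z, Cmod z <= M -> Cmod (F z) <= K.
Proof.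
  intros H M. destruct (H (Rmax M 0)) as [L [HL HF]].
  assert (H1 := Rmax_l M 0). assert (H2 := Rmax_r M 0).
  exists (L * Rmax M 0 + Cmod (F 0)). split.
  - assert (H3 := Cmod_ge_0 (F 0)). assert (0 <= L * Rmax M 0) by (apply Rmult_le_pos; lra). lra.
  - intros z Hz. replace (F z) with (F z - F 0 + F 0)%C by ring.
    apply Cmod_plus_le; [|lra]. eapply Rle_trans; [apply HF; [rewrite Cmod_0|]; lra|].
    apply Rmult_le_compat_l; [exact HL|]. replace (z - 0)%C with z by ring. lra.
Qed.

(** Adding the expansion at [z] to the one at [w] cancels the values of [F] and leaves (w - z) (F' w
    - F' z), bounded by 2 B |w - z|^2. Local uniformity of the remainder thus already gives
    regularity of the derivative. *)
Lemma hasderiv_loclip' F F' : hasderiv F F' -> loclip F'.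
Proof.
  intros H M. destruct (H M) as [B [HB HF]]. exists (2 * B). split; [lra|].
  intros z w Hz Hw.
  destruct (Req_dec (Cmod (w - z)) 0) as [E|E].
  - apply Cmod_eq_0 in E. replace w with z by (rewrite <- (Cplus_0_r z), <- E; ring).
    replace (F' z - F' z)%C with (0 : C) by ring. rewrite Cmod_0.
    replace (z - z)%C with (0 : C) by ring. rewrite Cmod_0. lra.
  - assert (Hp : 0 < Cmod (w - z)) by (assert (H1 := Cmod_ge_0 (w - z)); lra).
    apply Rmult_le_reg_l with (Cmod (w - z)); [exact Hp|].
    rewrite <- Cmod_mult.
    replace ((w - z) * (F' w - F' z))%C with
      ((F z - F w - (z - w) * F' w) + (F w - F z - (w - z) * F' z))%C by ring.
    replace (Cmod (w - z) * (2 * B * Cmod (w - z))) with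
      (B * Cmod (w - z) ^ 2 + B * Cmod (w - z) ^ 2) by ring.
    apply Cmod_plus_le; [|apply HF; assumption].
    rewrite (Cmod_sub_comm w z). apply HF; assumption.
Qed.

Lemma hasderiv_loclip F F' : hasderiv F F' -> loclip F.
Proof.
  intros H M. destruct (loclip_bounded F' (hasderiv_loclip' _ _ H) M) as [K [HK HF']].
  destruct (H M) as [B [HB HF]]. exists (2 * B * Rabs M + K). assert (HM := Rabs_pos M).
  split; [assert (0 <= 2 * B * Rabs M) by (repeat apply Rmult_le_pos; lra); lra|].
  intros z w Hz Hw.
  replace (F w - F z)%C with ((F w - F z - (w - z) * F' z) + (w - z) * F' z)%C by ring.
  rewrite Rmult_plus_distr_r. apply Cmod_plus_le.
  - eapply Rle_trans; [apply HF; assumption|].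
    replace (B * Cmod (w - z) ^ 2) with (B * Cmod (w - z) * Cmod (w - z)) by ring.
    apply Rmult_le_compat_r; [apply Cmod_ge_0|].
    replace (2 * B * Rabs M) with (B * (Rabs M + Rabs M)) by ring.
    apply Rmult_le_compat_l; [exact HB|].
    assert (HM' := Rle_abs M). apply Cmod_minus_le; lra.
  - rewrite Cmod_mult, Rmult_comm. apply Rmult_le_compat_r; [apply Cmod_ge_0|]. apply HF', Hz.
Qed.

Lemma smooth_loclip n F : smooth n F -> loclip F.
Proof.
  destruct n as [|n]; [exact (fun H => H)|]. intros [F' [H _]]. exact (hasderiv_loclip _ _ H).
Qed.

Lemma smooth_pred n F : smooth (S n) F -> smooth n F.
Proof.
  revert F. induction n as [|n IH]; intros F H.
  - exact (smooth_loclip 1 F H).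
  - destruct H as [F' [H1 H2]]. exists F'. split; [exact H1|]. apply IH, H2.
Qed.

Lemma hasderiv_const c : hasderiv (fun _ => c) (fun _ => 0%C).
Proof.
  intros M. exists 0. split; [lra|]. intros z w _ _.
  replace (c - c - (w - z) * 0)%C with (0 : C) by ring. rewrite Cmod_0. lra.
Qed.

Lemma hasderiv_id : hasderiv (fun z => z) (fun _ => 1%C).
Proof.
  intros M. exists 0. split; [lra|]. intros z w _ _.
  replace (w - z - (w - z) * 1)%C with (0 : C) by ring. rewrite Cmod_0. lra.
Qed.

Lemma smooth_const n c : smooth n (fun _ => c).
Proof.
  revert c. induction n as [|n IH]; intros c; [exact (hasderiv_loclip _ _ (hasderiv_const c))|].
  exists (fun _ => 0%C). split; [apply hasderiv_const|apply IH].
Qed.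

Lemma smooth_id n : smooth n (fun z => z).
Proof.
  destruct n as [|n]; [exact (hasderiv_loclip _ _ hasderiv_id)|].
  exists (fun _ => 1%C). split; [apply hasderiv_id|apply smooth_const].
Qed.

Lemma loclip_plus F G : loclip F -> loclip G -> loclip (fun z => F z + G z)%C.
Proof.
  intros HF HG M. destruct (HF M) as [L1 [HL1 H1]]. destruct (HG M) as [L2 [HL2 H2]].
  exists (L1 + L2). split; [lra|]. intros z w Hz Hw.
  replace (F w + G w - (F z + G z))%C with ((F w - F z) + (G w - G z))%C by ring.
  rewrite Rmult_plus_distr_r. apply Cmod_plus_le; [apply H1|apply H2]; assumption.
Qed.

Lemma loclip_mult F G : loclip F -> loclip G -> loclip (fun z => F z * G z)%C.
Proof.
  intros HF HG M. destruct (HF M) as [L1 [HL1 H1]]. destruct (HG M) as [L2 [HL2 H2]].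
  destruct (loclip_bounded F HF M) as [K1 [HK1 B1]]. destruct (loclip_bounded G HG M) as [K2 [HK2 B2]].
  exists (L1 * K2 + K1 * L2). split; [apply Rplus_le_le_0_compat; apply Rmult_le_pos; assumption|].
  intros z w Hz Hw.
  replace (F w * G w - F z * G z)%C with ((F w - F z) * G w + F z * (G w - G z))%C by ring.
  replace ((L1 * K2 + K1 * L2) * Cmod (w - z)) with
    (L1 * Cmod (w - z) * K2 + K1 * (L2 * Cmod (w - z))) by ring.
  apply Cmod_plus_le; apply Cmod_mult_le; auto.
Qed.

Lemma loclip_comp F G : loclip F -> loclip G -> loclip (fun z => F (G z)).
Proof.
  intros HF HG M. destruct (loclip_bounded G HG M) as [K [HK BG]].
  destruct (HG M) as [L2 [HL2 H2]]. destruct (HF K) as [L1 [HL1 H1]].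
  exists (L1 * L2). split; [apply Rmult_le_pos; assumption|]. intros z w Hz Hw.
  eapply Rle_trans; [apply H1; apply BG; assumption|].
  rewrite Rmult_assoc. apply Rmult_le_compat_l; [exact HL1|]. apply H2; assumption.
Qed.

Lemma hasderiv_plus F G F' G' :
  hasderiv F F' -> hasderiv G G' -> hasderiv (fun z => F z + G z)%C (fun z => F' z + G' z)%C.
Proof.
  intros HF HG M. destruct (HF M) as [B1 [HB1 H1]]. destruct (HG M) as [B2 [HB2 H2]].
  exists (B1 + B2). split; [lra|]. intros z w Hz Hw.
  replace (F w + G w - (F z + G z) - (w - z) * (F' z + G' z))%C with
    ((F w - F z - (w - z) * F' z) + (G w - G z - (w - z) * G' z))%C by ring.
  rewrite Rmult_plus_distr_r. apply Cmod_plus_le; [apply H1|apply H2]; assumption.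
Qed.

Lemma hasderiv_mult F G F' G' :
  hasderiv F F' -> hasderiv G G' ->
  hasderiv (fun z => F z * G z)%C (fun z => F' z * G z + F z * G' z)%C.
Proof.
  intros HF HG M. destruct (HF M) as [B1 [HB1 H1]]. destruct (HG M) as [B2 [HB2 H2]].
  destruct (loclip_bounded F (hasderiv_loclip _ _ HF) M) as [K1 [HK1 C1]].
  destruct (loclip_bounded F' (hasderiv_loclip' _ _ HF) M) as [K1' [HK1' C1']].
  destruct (loclip_bounded G (hasderiv_loclip _ _ HG) M) as [K2 [HK2 C2]].
  destruct (hasderiv_loclip _ _ HG M) as [L [HL HGL]].
  exists (B1 * K2 + K1' * L + K1 * B2).
  split; [repeat apply Rplus_le_le_0_compat; apply Rmult_le_pos; assumption|].
  intros z w Hz Hw.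
  replace (F w * G w - F z * G z - (w - z) * (F' z * G z + F z * G' z))%C with
    ((F w - F z - (w - z) * F' z) * G w + ((w - z) * F' z) * (G w - G z) +
     F z * (G w - G z - (w - z) * G' z))%C by ring.
  replace ((B1 * K2 + K1' * L + K1 * B2) * Cmod (w - z) ^ 2) with
    (B1 * Cmod (w - z) ^ 2 * K2 + (Cmod (w - z) * K1') * (L * Cmod (w - z)) +
     K1 * (B2 * Cmod (w - z) ^ 2)) by ring.
  repeat apply Cmod_plus_le; repeat apply Cmod_mult_le; auto. apply Rle_refl.
Qed.

Lemma hasderiv_comp F G F' G' :
  hasderiv F F' -> hasderiv G G' ->
  hasderiv (fun z => F (G z)) (fun z => F' (G z) * G' z)%C.
Proof.
  intros HF HG M.
  destruct (loclip_bounded G (hasderiv_loclip _ _ HG) M) as [K [HK BG]].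
  destruct (HF K) as [B1 [HB1 H1]]. destruct (HG M) as [B2 [HB2 H2]].
  destruct (loclip_bounded F' (hasderiv_loclip' _ _ HF) K) as [K1' [HK1' C1']].
  destruct (hasderiv_loclip _ _ HG M) as [L [HL HGL]].
  exists (B1 * L ^ 2 + K1' * B2).
  split.
  { apply Rplus_le_le_0_compat; apply Rmult_le_pos; try assumption. apply pow2_ge_0. }
  intros z w Hz Hw.
  replace (F (G w) - F (G z) - (w - z) * (F' (G z) * G' z))%C with
    ((F (G w) - F (G z) - (G w - G z) * F' (G z)) +
     F' (G z) * (G w - G z - (w - z) * G' z))%C by ring.
  replace ((B1 * L ^ 2 + K1' * B2) * Cmod (w - z) ^ 2) with
    (B1 * (L * Cmod (w - z)) ^ 2 + K1' * (B2 * Cmod (w - z) ^ 2)) by ring.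
  apply Cmod_plus_le.
  - eapply Rle_trans; [apply H1; apply BG; assumption|].
    apply Rmult_le_compat_l; [exact HB1|]. apply pow_incr. split; [apply Cmod_ge_0|].
    apply HGL; assumption.
  - apply Cmod_mult_le; auto.
Qed.

Lemma smooth_plus n F G : smooth n F -> smooth n G -> smooth n (fun z => F z + G z)%C.
Proof.
  revert F G. induction n as [|n IH]; intros F G; [apply loclip_plus|].
  intros [F' [H1 H2]] [G' [H3 H4]]. exists (fun z => F' z + G' z)%C.
  split; [apply hasderiv_plus; assumption|apply IH; assumption].
Qed.

Lemma smooth_mult n F G : smooth n F -> smooth n G -> smooth n (fun z => F z * G z)%C.
Proof.
  revert F G. induction n as [|n IH]; intros F G; [apply loclip_mult|].
  intros HF HG. assert (sF := smooth_pred _ _ HF). assert (sG := smooth_pred _ _ HG).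
  destruct HF as [F' [H1 H2]]. destruct HG as [G' [H3 H4]].
  exists (fun z => F' z * G z + F z * G' z)%C.
  split; [apply hasderiv_mult; assumption|]. apply smooth_plus; apply IH; assumption.
Qed.

Lemma smooth_comp n F G : smooth n F -> smooth n G -> smooth n (fun z => F (G z)).
Proof.
  revert F G. induction n as [|n IH]; intros F G; [apply loclip_comp|].
  intros HF HG. assert (sG := smooth_pred _ _ HG).
  destruct HF as [F' [H1 H2]]. destruct HG as [G' [H3 H4]].
  exists (fun z => F' (G z) * G' z)%C.
  split; [apply hasderiv_comp; assumption|].
  apply (smooth_mult n (fun z => F' (G z))); [apply IH|]; assumption.
Qed.

Lemma smooth_scal n c F : smooth n F -> smooth n (fun z => c * F z)%C.
Proof. apply (smooth_mult n (fun _ => c)), smooth_const. Qed.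

(** * The complex exponential *)

Definition Cexp (z : C) : C := (exp (fst z) * cos (snd z), exp (fst z) * sin (snd z)).

Lemma Cexp_plus z w : Cexp (z + w) = (Cexp z * Cexp w)%C.
Proof.
  destruct z as [x y], w as [x' y']. unfold Cexp, Cplus, Cmult; simpl.
  rewrite exp_plus, cos_plus, sin_plus. f_equal; ring.
Qed.

Lemma Cmod_Cexp z : Cmod (Cexp z) = exp (fst z).
Proof.
  unfold Cexp, Cmod; simpl fst; simpl snd.
  replace ((exp (fst z) * cos (snd z)) ^ 2 + (exp (fst z) * sin (snd z)) ^ 2) with
    (exp (fst z) * exp (fst z) * ((sin (snd z))² + (cos (snd z))²)) by (unfold Rsqr; ring).
  rewrite sin2_cos2, Rmult_1_r. apply sqrt_square. left. apply exp_pos.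
Qed.

Lemma abs_sin_le x : Rabs (sin x) <= Rabs x.
Proof. assert (H := sin_lipschitz x 0). rewrite sin_0, !Rminus_0_r in H. exact H. Qed.

Lemma abs_le_of_MVT (f f' : R -> R) (y : R) :
  (forall t, is_derive f t (f' t)) -> f 0 = 0 -> (forall t, Rabs (f' t) <= Rabs t) ->
  Rabs (f y) <= y ^ 2.
Proof.
  intros Hd H0 Hb. destruct (MVT_gen f 0 y f') as [c [Hc E]].
  - intros t _. apply Hd.
  - intros t _. apply continuity_pt_filterlim, (ex_derive_continuous (V := R_NormedModule)).
    eexists; apply Hd.
  - rewrite H0, !Rminus_0_r in E. rewrite E, Rabs_mult, <- pow2_abs.
    simpl. rewrite Rmult_1_r. apply Rmult_le_compat_r; [apply Rabs_pos|].
    eapply Rle_trans; [apply Hb|]. unfold Rmin, Rmax in Hc.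
    destruct (Rle_dec 0 y); unfold Rabs; destruct (Rcase_abs c), (Rcase_abs y); lra.
Qed.

Lemma abs_cos_sub_1_le y : Rabs (cos y - 1) <= y ^ 2.
Proof.
  apply (abs_le_of_MVT (fun t => cos t - 1) (fun t => - sin t)).
  - intros t. auto_derive; [exact I|ring].
  - rewrite cos_0. ring.
  - intros t. rewrite Rabs_Ropp. apply abs_sin_le.
Qed.

Lemma abs_sin_sub_id_le y : Rabs (sin y - y) <= y ^ 2.
Proof.
  apply (abs_le_of_MVT (fun t => sin t - t) (fun t => cos t - 1)).
  - intros t. auto_derive; [exact I|ring].
  - rewrite sin_0. ring.
  - intros t. assert (H := cos_lipschitz t 0). rewrite cos_0, Rminus_0_r in H. exact H.
Qed.

Lemma Cexp_remainder M h :
  Cmod h <= M -> Cmod (Cexp h - 1 - h) <= (4 * exp M + 2) * Cmod h ^ 2.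
Proof.
  intros Hh. destruct h as [x y].
  assert (Hx : Rabs x <= M) by (eapply Rle_trans; [apply (abs_fst_le_Cmod (x, y))|exact Hh]).
  assert (Hx' := Rle_abs x).
  assert (HE : exp x <= exp M).
  { destruct (Rle_lt_or_eq_dec x M) as [H|H]; [lra| |].
    - left. apply exp_increasing, H.
    - right. f_equal. exact H. }
  assert (HE0 := exp_pos x).
  assert (H2 : Cmod (x, y) ^ 2 = x ^ 2 + y ^ 2).
  { rewrite Cmod2_alt. reflexivity. }
  rewrite H2.
  assert (E1 := exp_ineq1_le x). assert (E2 := exp_ineq1_le (- x)).
  (* Together with exp x >= 1 + x this places exp x - 1 - x between 0 and x (exp x - 1), so the
     quadratic bound follows from the linear bound for exp x - 1. *)
  assert (E3 : exp x * (1 - x) <= 1).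
  { apply Rle_trans with (exp x * exp (- x)).
    - apply Rmult_le_compat_l; lra.
    - rewrite <- exp_plus, Rplus_opp_r, exp_0. apply Rle_refl. }
  assert (Hexp1 : Rabs (exp x - 1) <= (1 + exp M) * Rabs x).
  { unfold Rabs at 2. destruct (Rcase_abs x); apply Rabs_le; nra. }
  assert (Hexp2 : Rabs (exp x - 1 - x) <= (1 + exp M) * x ^ 2).
  { rewrite Rabs_right by lra. apply Rle_trans with (Rabs (x * (exp x - 1))).
    - eapply Rle_trans; [|apply Rle_abs]. lra.
    - rewrite Rabs_mult, <- (pow2_abs x).
      replace ((1 + exp M) * Rabs x ^ 2) with (Rabs x * ((1 + exp M) * Rabs x)) by ring.
      apply Rmult_le_compat_l; [apply Rabs_pos|exact Hexp1]. }
  assert (Hc := abs_cos_sub_1_le y). assert (Hs := abs_sin_sub_id_le y).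
  assert (Hy2 := pow2_ge_0 y). assert (Hx2 := pow2_ge_0 x).
  assert (P1 : Rabs (exp x * cos y - 1 - x) <= (1 + exp M) * x ^ 2 + exp M * y ^ 2).
  { replace (exp x * cos y - 1 - x) with ((exp x - 1 - x) + exp x * (cos y - 1)) by ring.
    eapply Rle_trans; [apply Rabs_triang|]. apply Rplus_le_compat; [exact Hexp2|].
    rewrite Rabs_mult. apply Rmult_le_compat; try apply Rabs_pos; [|exact Hc].
    rewrite Rabs_right; lra. }
  assert (P2 : Rabs (exp x * sin y - y) <= exp M * y ^ 2 + (1 + exp M) * (x ^ 2 + y ^ 2)).
  { replace (exp x * sin y - y) with (exp x * (sin y - y) + (exp x - 1) * y) by ring.
    eapply Rle_trans; [apply Rabs_triang|]. apply Rplus_le_compat; rewrite Rabs_mult.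
    - apply Rmult_le_compat; try apply Rabs_pos; [|exact Hs]. rewrite Rabs_right; lra.
    - apply Rle_trans with ((1 + exp M) * Rabs x * Rabs y).
      + apply Rmult_le_compat_r; [apply Rabs_pos|exact Hexp1].
      + rewrite Rmult_assoc. apply Rmult_le_compat_l; [lra|].
        rewrite <- (pow2_abs x), <- (pow2_abs y).
        assert (H3 := pow2_ge_0 (Rabs x - Rabs y)).
        assert (H4 : 0 <= Rabs x * Rabs y) by (apply Rmult_le_pos; apply Rabs_pos). nra. }
  eapply Rle_trans; [apply Cmod_le_sum|].
  unfold Cexp, Cminus, Cplus, Copp, RtoC; simpl fst; simpl snd.
  replace (exp x * cos y + - (1) + - x) with (exp x * cos y - 1 - x) by ring.
  replace (exp x * sin y + - 0 + - y) with (exp x * sin y - y) by ring.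
  assert (0 <= exp M * x ^ 2) by (apply Rmult_le_pos; lra).
  assert (0 <= exp M * y ^ 2) by (apply Rmult_le_pos; lra).
  lra.
Qed.

Lemma hasderiv_Cexp : hasderiv Cexp Cexp.
Proof.
  intros M. exists (exp (Rabs M) * (4 * exp (2 * Rabs M) + 2)). split.
  { assert (H1 := exp_pos (Rabs M)). assert (H2 := exp_pos (2 * Rabs M)).
    apply Rmult_le_pos; lra. }
  intros z w Hz Hw. assert (HM := Rle_abs M).
  replace w with (z + (w - z))%C at 1 by ring. rewrite Cexp_plus.
  replace (Cexp z * Cexp (w - z) - Cexp z - (w - z) * Cexp z)%C with
    (Cexp z * (Cexp (w - z) - 1 - (w - z)))%C by ring.
  rewrite Rmult_assoc. apply Cmod_mult_le.
  - rewrite Cmod_Cexp.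
    assert (Hf : fst z <= Rabs M).
    { eapply Rle_trans; [apply Rle_abs|]. eapply Rle_trans; [apply abs_fst_le_Cmod|]. lra. }
    destruct Hf as [Hf| ->]; [left; apply exp_increasing, Hf|apply Rle_refl].
  - apply Cexp_remainder. replace (2 * Rabs M) with (Rabs M + Rabs M) by ring.
    apply Cmod_minus_le; lra.
Qed.

Lemma smooth_Cexp n : smooth n Cexp.
Proof.
  induction n as [|n IH]; [exact (hasderiv_loclip _ _ hasderiv_Cexp)|].
  exists Cexp. split; [apply hasderiv_Cexp|exact IH].
Qed.

(** * Complex-valued integrals *)

Definition Ccont (f : R -> C) : Prop :=
  continuity (fun t => fst (f t)) /\ continuity (fun t => snd (f t)).

Definition CRInt (f : R -> C) (a b : R) : C :=
  (RInt (fun t => fst (f t)) a b, RInt (fun t => snd (f t)) a b).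

Lemma continuity_eps (f : R -> R) t eps : continuity f -> 0 < eps ->
  exists d, 0 < d /\ forall s, Rabs (s - t) < d -> Rabs (f s - f t) < eps.
Proof.
  intros H He. destruct (H t eps He) as [d [Hd Hs]]. exists d. split; [exact Hd|].
  intros s Hst. destruct (Req_dec t s) as [<-|N].
  - rewrite Rminus_diag, Rabs_R0. exact He.
  - apply Hs. split; [split; [exact I|exact N]|exact Hst].
Qed.

Lemma continuity_cst (c : R) : continuity (fun _ => c).
Proof. apply continuity_const. intros ? ?; reflexivity. Qed.

Lemma Ccont_const c : Ccont (fun _ => c).
Proof. split; apply continuity_cst. Qed.

Lemma Ccont_RtoC f : continuity f -> Ccont (fun t => RtoC (f t)).
Proof. intros H. split; [exact H|exact (continuity_cst 0)]. Qed.

Lemma Ccont_plus f g : Ccont f -> Ccont g -> Ccont (fun t => f t + g t)%C.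
Proof.
  intros [F1 F2] [G1 G2]. split; [exact (continuity_plus _ _ F1 G1)|exact (continuity_plus _ _ F2 G2)].
Qed.

Lemma Ccont_mult f g : Ccont f -> Ccont g -> Ccont (fun t => f t * g t)%C.
Proof.
  intros [F1 F2] [G1 G2]. split.
  - exact (continuity_minus _ _ (continuity_mult _ _ F1 G1) (continuity_mult _ _ F2 G2)).
  - exact (continuity_plus _ _ (continuity_mult _ _ F1 G2) (continuity_mult _ _ F2 G1)).
Qed.

Lemma Ccont_comp (F : C -> C) (g : R -> C) : loclip F -> Ccont g -> Ccont (fun t => F (g t)).
Proof.
  intros HF [H1 H2].
  assert (H : forall t eps, 0 < eps -> exists d, 0 < d /\
    forall s, Rabs (s - t) < d -> Cmod (F (g s) - F (g t)) < eps).
  { intros t eps He. destruct (HF (Cmod (g t) + 1)) as [L [HL HLF]].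
    (* The bound 1/2 keeps [g s] in the ball of radius |g t| + 1, where the Lipschitz constant [L]
       is valid. *)
    set (e := Rmin (1 / 2) (eps / (2 * (L + 1)))).
    assert (He0 : 0 < e).
    { apply Rmin_glb_lt; [lra|]. apply Rdiv_lt_0_compat; lra. }
    assert (e1 : e <= 1 / 2) by apply Rmin_l.
    assert (e2 : e <= eps / (2 * (L + 1))) by apply Rmin_r.
    destruct (continuity_eps _ t e H1 He0) as [d1 [Hd1 C1]].
    destruct (continuity_eps _ t e H2 He0) as [d2 [Hd2 C2]].
    exists (Rmin d1 d2). split; [apply Rmin_glb_lt; assumption|].
    intros s Hs.
    assert (Hg : Cmod (g s - g t) <= 2 * e).
    { eapply Rle_trans; [apply Cmod_le_sum|].
      assert (K1 := C1 s (Rlt_le_trans _ _ _ Hs (Rmin_l _ _))).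
      assert (K2 := C2 s (Rlt_le_trans _ _ _ Hs (Rmin_r _ _))).
      simpl. unfold Rminus in K1, K2. lra. }
    assert (Hgs : Cmod (g s) <= Cmod (g t) + 1).
    { replace (g s) with (g t + (g s - g t))%C by ring. apply Cmod_plus_le; lra. }
    eapply Rle_lt_trans; [apply HLF; lra|].
    apply Rle_lt_trans with (L * (2 * e)); [apply Rmult_le_compat_l; lra|].
    apply Rle_lt_trans with (L * (2 * (eps / (2 * (L + 1))))); [apply Rmult_le_compat_l; lra|].
    assert (0 < eps / (L + 1)) by (apply Rdiv_lt_0_compat; lra).
    replace (L * (2 * (eps / (2 * (L + 1))))) with (eps - eps / (L + 1)) by (field; lra). lra. }
  split; intros t eps He; destruct (H t eps He) as [d [Hd Hs]]; exists d; (split; [exact Hd|]);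
    intros s [_ Hst]; simpl in *; unfold Rdist in *; specialize (Hs s Hst).
  - eapply Rle_lt_trans; [|exact Hs]. apply (abs_fst_le_Cmod (F (g s) - F (g t))).
  - eapply Rle_lt_trans; [|exact Hs]. apply (abs_snd_le_Cmod (F (g s) - F (g t))).
Qed.

Lemma Ccont_scal_RtoC (z : C) : Ccont (fun t => RtoC t * z)%C.
Proof.
  apply (Ccont_mult (fun t => RtoC t)); [|apply Ccont_const].
  apply Ccont_RtoC. intros t. apply derivable_continuous_pt, derivable_pt_id.
Qed.

Lemma CRInt_ext f g a b : (forall t, f t = g t) -> CRInt f a b = CRInt g a b.
Proof.
  intros H. unfold CRInt. f_equal; apply RInt_Rext; intros t _; rewrite H; reflexivity.
Qed.

Lemma CRInt_minus f g a b : Ccont f -> Ccont g ->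
  CRInt (fun t => f t - g t)%C a b = (CRInt f a b - CRInt g a b)%C.
Proof.
  intros [F1 F2] [G1 G2]. unfold CRInt, Cminus, Cplus, Copp; simpl. f_equal.
  - apply (RInt_Rminus (fun t => fst (f t))); apply ex_RInt_continuity; assumption.
  - apply (RInt_Rminus (fun t => snd (f t))); apply ex_RInt_continuity; assumption.
Qed.

Lemma CRInt_scal c f a b : Ccont f -> CRInt (fun t => c * f t)%C a b = (c * CRInt f a b)%C.
Proof.
  intros [F1 F2]. unfold CRInt, Cmult; simpl.
  apply (fun H => ex_RInt_continuity _ a b H) in F1, F2. f_equal.
  - rewrite RInt_Rminus by (apply ex_RInt_Rscal; assumption).
    rewrite !RInt_Rscal by assumption. reflexivity.
  - rewrite RInt_Rplus by (apply ex_RInt_Rscal; assumption).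
    rewrite !RInt_Rscal by assumption. reflexivity.
Qed.

Lemma CRInt_const c a b : CRInt (fun _ => c) a b = (RtoC (b - a) * c)%C.
Proof.
  unfold CRInt. rewrite !RInt_Rconst. unfold Cmult, RtoC; simpl. f_equal; ring.
Qed.

Lemma CRInt_Chasles f a b c : Ccont f -> CRInt f a c = (CRInt f a b + CRInt f b c)%C.
Proof.
  intros [F1 F2]. unfold CRInt, Cplus; simpl.
  f_equal; apply RInt_Chasles_R; apply ex_RInt_continuity; assumption.
Qed.

Lemma CRInt_point f a : CRInt f a a = 0.
Proof. unfold CRInt. rewrite !RInt_Rpoint. reflexivity. Qed.

Lemma Cmod_CRInt_le f a b K : a <= b -> Ccont f ->
  (forall t, a <= t <= b -> Cmod (f t) <= K) -> Cmod (CRInt f a b) <= 2 * ((b - a) * K).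
Proof.
  intros Hab [F1 F2] H. eapply Rle_trans; [apply Cmod_le_sum|]. simpl.
  replace (2 * ((b - a) * K)) with ((b - a) * K + (b - a) * K) by ring.
  apply Rplus_le_compat; (apply abs_RInt_le_const; [exact Hab|apply ex_RInt_continuity; assumption|]);
    intros t Ht; (eapply Rle_trans; [|apply (H t Ht)]).
  - apply abs_fst_le_Cmod.
  - apply abs_snd_le_Cmod.
Qed.

Lemma quadratic_increments_constant_C (D : R -> C) (K p q : R) :
  p <= q ->
  (forall x y, p <= x -> x <= y -> y <= q -> Cmod (D y - D x) <= K * (y - x) ^ 2) ->
  D q = D p.
Proof.
  intros Hpq H. rewrite (surjective_pairing (D q)), (surjective_pairing (D p)). f_equal.
  - apply (quadratic_increments_constant (fun t => fst (D t)) K p q Hpq).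
    intros x y H1 H2 H3. eapply Rle_trans; [|apply (H x y H1 H2 H3)].
    apply (abs_fst_le_Cmod (D y - D x)).
  - apply (quadratic_increments_constant (fun t => snd (D t)) K p q Hpq).
    intros x y H1 H2 H3. eapply Rle_trans; [|apply (H x y H1 H2 H3)].
    apply (abs_snd_le_Cmod (D y - D x)).
Qed.

Lemma continuity_bounded (a : R -> R) p q : p <= q -> continuity a ->
  exists K, 0 <= K /\ forall t, p <= t <= q -> Rabs (a t) <= K.
Proof.
  intros Hpq Ha. destruct (ex_RInt_ub a p q (ex_RInt_continuity a p q Ha)) as [K HK].
  rewrite Rmin_left, Rmax_right in HK by exact Hpq. exists K. split.
  - eapply Rle_trans; [apply Rabs_pos|]. apply (HK p). lra.
  - exact HK.
Qed.

Lemma Cmod_RtoC_mult_le t z b M : 0 <= t <= b -> Cmod z <= M -> Cmod (RtoC t * z) <= b * M.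
Proof.
  intros Ht Hz. apply Cmod_mult_le; [|exact Hz]. rewrite Cmod_R, Rabs_right; lra.
Qed.

(** Differentiation under the integral sign: the remainder of [F] is uniform on the ball of radius b
    M, so it can be integrated. Deriving in [z] changes the weight [a t] into [a t * t], which is
    why the induction runs over all continuous weights. *)
Lemma smooth_integral n (F : C -> C) (a : R -> R) (b : R) :
  0 <= b -> continuity a -> smooth n F ->
  smooth n (fun z => CRInt (fun t => RtoC (a t) * F (RtoC t * z)) 0 b)%C.
Proof.
  intros Hb. revert F a. induction n as [|n IH]; intros F a Ha HF.
  - destruct (continuity_bounded a 0 b Hb Ha) as [K [HK Ka]].
    assert (HC : forall z, Ccont (fun t => RtoC (a t) * F (RtoC t * z))%C).
    { intros z. apply Ccont_mult; [apply Ccont_RtoC, Ha|]. apply Ccont_comp; [exact HF|].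
      apply Ccont_scal_RtoC. }
    intros M. destruct (HF (b * M)) as [L [HL HLF]].
    exists (2 * (b * (K * (L * b)))). split; [repeat apply Rmult_le_pos; lra|].
    intros z w Hz Hw. rewrite <- CRInt_minus by apply HC.
    replace (2 * (b * (K * (L * b))) * Cmod (w - z)) with
      (2 * ((b - 0) * (K * (L * (b * Cmod (w - z)))))) by ring.
    apply Cmod_CRInt_le; [exact Hb| |].
    + apply Ccont_plus; [apply HC|]. destruct (HC z) as [C1 C2].
      split; [exact (continuity_opp _ C1)|exact (continuity_opp _ C2)].
    + intros t Ht.
      replace (RtoC (a t) * F (RtoC t * w) - RtoC (a t) * F (RtoC t * z))%C with
        (RtoC (a t) * (F (RtoC t * w) - F (RtoC t * z)))%C by ring.
      apply Cmod_mult_le; [rewrite Cmod_R; apply Ka, Ht|].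
      eapply Rle_trans; [apply HLF; apply Cmod_RtoC_mult_le; assumption|].
      apply Rmult_le_compat_l; [exact HL|].
      replace (RtoC t * w - RtoC t * z)%C with (RtoC t * (w - z))%C by ring.
      apply Cmod_RtoC_mult_le; [exact Ht|apply Rle_refl].
  - assert (HF0 := smooth_loclip _ _ HF). destruct HF as [F' [HF1 HF2]].
    assert (Ha' : continuity (fun t => a t * t)).
    { apply (continuity_mult a (fun t => t)); [exact Ha|].
      intros t. apply derivable_continuous_pt, derivable_pt_id. }
    exists (fun z => CRInt (fun t => RtoC (a t * t) * F' (RtoC t * z)) 0 b)%C.
    split; [|apply IH; assumption].
    destruct (continuity_bounded a 0 b Hb Ha) as [K [HK Ka]].
    assert (HC : forall z, Ccont (fun t => RtoC (a t) * F (RtoC t * z))%C).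
    { intros z. apply Ccont_mult; [apply Ccont_RtoC, Ha|]. apply Ccont_comp; [exact HF0|].
      apply Ccont_scal_RtoC. }
    assert (HC' : forall z, Ccont (fun t => RtoC (a t * t) * F' (RtoC t * z))%C).
    { intros z. apply Ccont_mult; [apply Ccont_RtoC, Ha'|].
      apply Ccont_comp; [exact (hasderiv_loclip' _ _ HF1)|]. apply Ccont_scal_RtoC. }
    assert (Copp' : forall f, Ccont f -> Ccont (fun t => - f t)%C).
    { intros f [C1 C2]. split; [exact (continuity_opp _ C1)|exact (continuity_opp _ C2)]. }
    intros M. destruct (HF1 (b * M)) as [B [HB HBF]].
    exists (2 * (b * (K * (B * b ^ 2)))).
    split; [repeat apply Rmult_le_pos; try lra; apply pow2_ge_0|].
    intros z w Hz Hw.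
    rewrite <- CRInt_scal by apply HC'.
    assert (HCs : Ccont (fun t => (w - z) * (RtoC (a t * t) * F' (RtoC t * z)))%C).
    { apply Ccont_mult; [apply Ccont_const|apply HC']. }
    assert (HCd : Ccont (fun t => RtoC (a t) * F (RtoC t * w) - RtoC (a t) * F (RtoC t * z))%C).
    { apply Ccont_plus; [apply HC|apply Copp', HC]. }
    rewrite <- CRInt_minus by apply HC. rewrite <- CRInt_minus by assumption.
    replace (2 * (b * (K * (B * b ^ 2))) * Cmod (w - z) ^ 2) with
      (2 * ((b - 0) * (K * (B * (b * Cmod (w - z)) ^ 2)))) by ring.
    apply Cmod_CRInt_le; [exact Hb|apply Ccont_plus; [exact HCd|apply Copp', HCs]|].
    intros t Ht.
    replace (RtoC (a t) * F (RtoC t * w) - RtoC (a t) * F (RtoC t * z) -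
       (w - z) * (RtoC (a t * t) * F' (RtoC t * z)))%C with
      (RtoC (a t) * (F (RtoC t * w) - F (RtoC t * z) - (RtoC t * w - RtoC t * z) * F' (RtoC t * z)))%C
      by (rewrite RtoC_mult; ring).
    apply Cmod_mult_le; [rewrite Cmod_R; apply Ka, Ht|].
    eapply Rle_trans; [apply HBF; apply Cmod_RtoC_mult_le; assumption|].
    apply Rmult_le_compat_l; [exact HB|]. apply pow_incr. split; [apply Cmod_ge_0|].
    replace (RtoC t * w - RtoC t * z)%C with (RtoC t * (w - z))%C by ring.
    apply Cmod_RtoC_mult_le; [exact Ht|apply Rle_refl].
Qed.

(** Over [s, t] the difference between F(g) and the integral changes by three quadratic errors: the
    remainder of [F], the remainder of [g], and the variation of the integrand. The path is
    described by explicit bounds with a single [K], which is the form this count requires. *)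
Lemma integral_along_path (F F' : C -> C) (g g' : R -> C) (K p q : R) :
  p <= q -> hasderiv F F' -> Ccont g -> Ccont g' -> 0 <= K ->
  (forall t, p <= t <= q -> Cmod (g t) <= K) ->
  (forall t, p <= t <= q -> Cmod (g' t) <= K) ->
  (forall s t, p <= s -> s <= t -> t <= q -> Cmod (g t - g s) <= K * (t - s)) ->
  (forall s t, p <= s -> s <= t -> t <= q -> Cmod (g' t - g' s) <= K * (t - s)) ->
  (forall s t, p <= s -> s <= t -> t <= q ->
     Cmod (g t - g s - RtoC (t - s) * g' s) <= K * (t - s) ^ 2) ->
  (F (g q) - F (g p))%C = CRInt (fun t => g' t * F' (g t))%C p q.
Proof.
  intros Hpq HF Hg Hg' HK Bg Bg' Lg Lg' Qg.
  assert (HF' := hasderiv_loclip' _ _ HF).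
  assert (HC : Ccont (fun t => g' t * F' (g t))%C).
  { apply Ccont_mult; [exact Hg'|]. apply Ccont_comp; assumption. }
  destruct (HF K) as [B [HB HBF]]. destruct (loclip_bounded F' HF' K) as [K' [HK' BF']].
  destruct (HF' K) as [L [HL HLF]].
  set (D := fun t => (F (g t) - CRInt (fun t => g' t * F' (g t)) p t)%C).
  assert (HD : D q = D p).
  { apply (quadratic_increments_constant_C D (B * K ^ 2 + K * K' + 2 * (K * K' + K * (L * K)))); [exact Hpq|].
    intros s t Hs Hst Ht. unfold D.
    rewrite (CRInt_Chasles _ p s t) by exact HC.
    set (I := CRInt _ s t).
    replace (F (g t) - (CRInt (fun t => g' t * F' (g t)) p s + I) -
       (F (g s) - CRInt (fun t => g' t * F' (g t)) p s))%C with
      ((F (g t) - F (g s) - (g t - g s) * F' (g s)) + (g t - g s - RtoC (t - s) * g' s) * F' (g s)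
       - (I - RtoC (t - s) * (g' s * F' (g s))))%C by ring.
    rewrite Rmult_plus_distr_r. apply Cmod_minus_le.
    - rewrite Rmult_plus_distr_r. apply Cmod_plus_le.
      + eapply Rle_trans; [apply HBF; apply Bg; lra|].
        rewrite Rmult_assoc. apply Rmult_le_compat_l; [exact HB|].
        rewrite <- Rpow_mult_distr. apply pow_incr. split; [apply Cmod_ge_0|apply Lg; assumption].
      + replace (K * K' * (t - s) ^ 2) with (K * (t - s) ^ 2 * K') by ring.
        apply Cmod_mult_le; [apply Qg; assumption|apply BF', Bg; lra].
    - unfold I. rewrite <- (CRInt_const (g' s * F' (g s)) s t).
      rewrite <- CRInt_minus; [|exact HC|apply Ccont_const].
      replace (2 * (K * K' + K * (L * K)) * (t - s) ^ 2) with
        (2 * ((t - s) * ((K * K' + K * (L * K)) * (t - s)))) by ring.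
      apply Cmod_CRInt_le; [exact Hst| |].
      { apply Ccont_plus; [exact HC|apply Ccont_const]. }
      intros x Hx.
      replace (g' x * F' (g x) - g' s * F' (g s))%C with
        ((g' x - g' s) * F' (g x) + g' s * (F' (g x) - F' (g s)))%C by ring.
      apply Rle_trans with (K * (x - s) * K' + K * (L * (K * (x - s)))).
      + apply Cmod_plus_le; apply Cmod_mult_le.
        * apply Lg'; lra.
        * apply BF', Bg; lra.
        * apply Bg'; lra.
        * eapply Rle_trans; [apply HLF; apply Bg; lra|].
          apply Rmult_le_compat_l; [exact HL|]. apply Lg; lra.
      + replace (K * (x - s) * K' + K * (L * (K * (x - s)))) with
          ((K * K' + K * (L * K)) * (x - s)) by ring.
        apply Rmult_le_compat_l; [|lra].
        apply Rplus_le_le_0_compat; repeat apply Rmult_le_pos; assumption. }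
  unfold D in HD. rewrite CRInt_point in HD.
  rewrite <- (Cplus_0_r (CRInt _ p q)).
  replace (F (g q)) with ((F (g q) - CRInt (fun t => g' t * F' (g t)) p q) +
    CRInt (fun t => g' t * F' (g t)) p q)%C by ring.
  rewrite HD. ring.
Qed.

(** Hadamard's formula: the quotient is the integral of F'(t z) over t in [0, 1], so there is no
    singularity at 0 to remove. The factor [RtoC 1] is the constant weight that [smooth_integral]
    expects. *)
Lemma smooth_divided_difference n F : smooth (S n) F ->
  exists G, smooth n G /\ forall z, (F z - F 0 = z * G z)%C.
Proof.
  intros [F' [H1 H2]].
  exists (fun z => CRInt (fun t => RtoC 1 * F' (RtoC t * z)) 0 1)%C. split.
  - apply (smooth_integral n F' (fun _ => 1)); [lra|apply continuity_cst|exact H2].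
  - intros z. assert (Hz := Cmod_ge_0 z).
    assert (HC : Ccont (fun t => RtoC 1 * F' (RtoC t * z))%C).
    { apply Ccont_mult; [apply Ccont_const|].
      apply Ccont_comp; [exact (hasderiv_loclip' _ _ H1)|apply Ccont_scal_RtoC]. }
    rewrite <- CRInt_scal by exact HC.
    assert (H0 := integral_along_path F F' (fun t => RtoC t * z)%C (fun _ => z) (Cmod z) 0 1
      ltac:(lra) H1 (Ccont_scal_RtoC z) (Ccont_const z) Hz).
    cbv beta in H0.
    replace (RtoC 1 * z)%C with z in H0 by ring. replace (RtoC 0 * z)%C with (RtoC 0) in H0 by ring.
    rewrite H0.
    + apply CRInt_ext. intros t. ring.
    + intros t Ht. rewrite <- (Rmult_1_l (Cmod z)). apply Cmod_RtoC_mult_le; [exact Ht|apply Rle_refl].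
    + intros; apply Rle_refl.
    + intros s t _ Hst _. replace (RtoC t * z - RtoC s * z)%C with (RtoC (t - s) * z)%C
        by (rewrite RtoC_minus; ring).
      rewrite Cmod_mult, Cmod_R, Rabs_right by lra. lra.
    + intros s t _ Hst _. replace (z - z)%C with (RtoC 0) by ring. rewrite Cmod_0.
      apply Rmult_le_pos; lra.
    + intros s t _ Hst _. replace (RtoC t * z - RtoC s * z - RtoC (t - s) * z)%C with (RtoC 0)
        by (rewrite RtoC_minus; ring).
      rewrite Cmod_0. apply Rmult_le_pos; [lra|apply pow2_ge_0].
Qed.

(** * The mean value property *)

Definition cis (t : R) : C := (cos t, sin t).

Lemma cis_Cexp t : cis t = Cexp (0, t).
Proof. unfold cis, Cexp; simpl. rewrite exp_0, !Rmult_1_l. reflexivity. Qed.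

Lemma Cmod_cis t : Cmod (cis t) = 1.
Proof. rewrite cis_Cexp, Cmod_Cexp. apply exp_0. Qed.

Lemma cis_plus s t : cis (s + t) = (cis s * cis t)%C.
Proof. unfold cis, Cmult; simpl. rewrite cos_plus, sin_plus. f_equal; ring. Qed.

Lemma Ccont_cis : Ccont cis.
Proof. split; [exact continuity_cos|exact continuity_sin]. Qed.

Lemma cis_lipschitz s t : s <= t -> Cmod (cis t - cis s) <= 2 * (t - s).
Proof.
  intros H. eapply Rle_trans; [apply Cmod_le_sum|]. simpl.
  assert (H1 := cos_lipschitz t s). assert (H2 := sin_lipschitz t s).
  rewrite (Rabs_right (t - s)) in H1, H2 by lra. unfold Rminus in *. lra.
Qed.

Lemma cis_remainder s t : s <= t -> Cmod (cis t - cis s - RtoC (t - s) * (Ci * cis s)) <= 2 * (t - s) ^ 2.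
Proof.
  intros H. replace t with (s + (t - s)) at 1 by ring. rewrite cis_plus.
  set (h := t - s).
  replace (cis s * cis h - cis s - RtoC h * (Ci * cis s))%C with
    (cis s * (cis h - 1 - RtoC h * Ci))%C by ring.
  rewrite Cmod_mult, Cmod_cis, Rmult_1_l.
  eapply Rle_trans; [apply Cmod_le_sum|]. simpl.
  assert (H1 := abs_cos_sub_1_le h). assert (H2 := abs_sin_sub_id_le h).
  replace (cos h + - (1) + - (h * 0 - 0 * 1)) with (cos h - 1) by ring.
  replace (sin h + - 0 + - (h * 1 + 0 * 0)) with (sin h - h) by ring. simpl in *. lra.
Qed.

Lemma Ccont_circle w r : Ccont (fun t => w + RtoC r * cis t)%C.
Proof.
  apply Ccont_plus; [apply Ccont_const|]. apply Ccont_mult; [apply Ccont_const|apply Ccont_cis].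
Qed.

Lemma Cmod_circle w r t : 0 <= r -> Cmod (w + RtoC r * cis t) <= Cmod w + r.
Proof.
  intros Hr. apply Cmod_plus_le; [apply Rle_refl|].
  rewrite Cmod_mult, Cmod_R, Cmod_cis, Rabs_right; lra.
Qed.

(** The circle closes up, so F takes the same value at both ends of the path; the velocity is
    [RtoC r * Ci * cis t], whose nonzero constant r i divides out. *)
Lemma circle_integral_deriv (F F' : C -> C) w r : hasderiv F F' -> 0 < r ->
  CRInt (fun t => cis t * F' (w + RtoC r * cis t))%C 0 (2 * PI) = 0.
Proof.
  intros HF Hr. assert (HP := PI_RGT_0). assert (Hw := Cmod_ge_0 w).
  assert (Hn : Cmod (RtoC r * Ci) = r).
  { rewrite Cmod_mult, Cmod_R, Cmod_Ci, Rabs_right; lra. }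
  assert (H0 := integral_along_path F F' (fun t => w + RtoC r * cis t)%C
    (fun t => RtoC r * Ci * cis t)%C (Cmod w + 2 * r) 0 (2 * PI) ltac:(lra) HF (Ccont_circle w r)).
  cbv beta in H0. assert (E : cis (2 * PI) = cis 0).
  { unfold cis. rewrite cos_2PI, sin_2PI, cos_0, sin_0. reflexivity. }
  rewrite E in H0.
  assert (HC : Ccont (fun t => cis t * F' (w + RtoC r * cis t))%C).
  { apply Ccont_mult; [apply Ccont_cis|]. apply Ccont_comp; [exact (hasderiv_loclip' _ _ HF)|].
    apply Ccont_circle. }
  rewrite (CRInt_ext (fun t => RtoC r * Ci * cis t * F' (w + RtoC r * cis t))%C
    (fun t => RtoC r * Ci * (cis t * F' (w + RtoC r * cis t)))%C) in H0 by (intros t; ring).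
  rewrite CRInt_scal in H0 by exact HC.
  apply Cmod_eq_0.
  apply Rmult_eq_reg_l with r; [|lra]. rewrite Rmult_0_r. rewrite <- Hn at 1.
  rewrite <- Cmod_mult, <- H0.
  - unfold Cminus. rewrite Cplus_opp_r. apply Cmod_0.
  - apply Ccont_mult; [apply Ccont_const|apply Ccont_cis].
  - lra.
  - intros t _. eapply Rle_trans; [apply Cmod_circle; lra|lra].
  - intros t _. rewrite Cmod_mult, Hn, Cmod_cis. lra.
  - intros s t _ Hst _.
    replace (w + RtoC r * cis t - (w + RtoC r * cis s))%C with (RtoC r * (cis t - cis s))%C by ring.
    rewrite Cmod_mult, Cmod_R, Rabs_right by lra.
    apply Rle_trans with (r * (2 * (t - s))); [apply Rmult_le_compat_l; [lra|apply cis_lipschitz, Hst]|].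
    assert (0 <= Cmod w * (t - s)) by (apply Rmult_le_pos; lra). lra.
  - intros s t _ Hst _.
    replace (RtoC r * Ci * cis t - RtoC r * Ci * cis s)%C with (RtoC r * Ci * (cis t - cis s))%C by ring.
    rewrite Cmod_mult, Hn.
    apply Rle_trans with (r * (2 * (t - s))); [apply Rmult_le_compat_l; [lra|apply cis_lipschitz, Hst]|].
    assert (0 <= Cmod w * (t - s)) by (apply Rmult_le_pos; lra). lra.
  - intros s t _ Hst _.
    replace (w + RtoC r * cis t - (w + RtoC r * cis s) - RtoC (t - s) * (RtoC r * Ci * cis s))%C with
      (RtoC r * (cis t - cis s - RtoC (t - s) * (Ci * cis s)))%C by ring.
    rewrite Cmod_mult, Cmod_R, Rabs_right by lra.
    apply Rle_trans with (r * (2 * (t - s) ^ 2)); [apply Rmult_le_compat_l; [lra|apply cis_remainder, Hst]|].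
    assert (0 <= Cmod w * (t - s) ^ 2) by (apply Rmult_le_pos; [lra|apply pow2_ge_0]). lra.
Qed.

(** The derivative of the circle mean with respect to the radius is the integral of
    [circle_integral_deriv], which vanishes. The mean is therefore constant in the radius and equals
    its value at radius 0. *)
Lemma mean_value_property (F F' : C -> C) w r : hasderiv F F' -> 0 <= r ->
  (RtoC (2 * PI) * F w)%C = CRInt (fun t => F (w + RtoC r * cis t))%C 0 (2 * PI).
Proof.
  intros HF Hr. assert (HP := PI_RGT_0).
  set (M := fun r => CRInt (fun t => F (w + RtoC r * cis t))%C 0 (2 * PI)).
  assert (HC : forall r, Ccont (fun t => F (w + RtoC r * cis t))%C).
  { intros x. apply Ccont_comp; [exact (hasderiv_loclip _ _ HF)|apply Ccont_circle]. }
  assert (HC' : forall r, Ccont (fun t => cis t * F' (w + RtoC r * cis t))%C).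
  { intros x. apply Ccont_mult; [apply Ccont_cis|].
    apply Ccont_comp; [exact (hasderiv_loclip' _ _ HF)|apply Ccont_circle]. }
  assert (H0 : forall x, 0 <= x -> CRInt (fun t => cis t * F' (w + RtoC x * cis t))%C 0 (2 * PI) = 0).
  { intros x [Hx| <-]; [apply circle_integral_deriv with F; assumption|].
    assert (H1 := circle_integral_deriv (fun z => z) (fun _ => 1%C) 0 1 hasderiv_id ltac:(lra)).
    rewrite (CRInt_ext _ cis) in H1 by (intros t; ring).
    rewrite (CRInt_ext _ (fun t => F' w * cis t)%C).
    - rewrite CRInt_scal by apply Ccont_cis. rewrite H1. ring.
    - intros t. replace (w + RtoC 0 * cis t)%C with w by ring. ring. }
  destruct (HF (Cmod w + r)) as [B [HB HBF]].
  assert (HM : M r = M 0).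
  { apply (quadratic_increments_constant_C M (2 * (2 * PI * B))); [exact Hr|].
    intros x y Hx Hxy Hy. unfold M.
    rewrite <- CRInt_minus by apply HC.
    replace (CRInt (fun t => F (w + RtoC y * cis t) - F (w + RtoC x * cis t)) 0 (2 * PI))%C with
      (CRInt (fun t => F (w + RtoC y * cis t) - F (w + RtoC x * cis t)) 0 (2 * PI) -
       RtoC (y - x) * CRInt (fun t => cis t * F' (w + RtoC x * cis t)) 0 (2 * PI))%C
      by (rewrite H0 by lra; ring).
    rewrite <- CRInt_scal by apply HC'.
    assert (HCd : Ccont (fun t => F (w + RtoC y * cis t) - F (w + RtoC x * cis t))%C).
    { apply Ccont_plus; [apply HC|]. destruct (HC x) as [C1 C2].
      split; [exact (continuity_opp _ C1)|exact (continuity_opp _ C2)]. }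
    assert (HCs : Ccont (fun t => RtoC (y - x) * (cis t * F' (w + RtoC x * cis t)))%C).
    { apply Ccont_mult; [apply Ccont_const|apply HC']. }
    rewrite <- CRInt_minus by assumption.
    replace (2 * (2 * PI * B) * (y - x) ^ 2) with (2 * ((2 * PI - 0) * (B * (y - x) ^ 2))) by ring.
    apply Cmod_CRInt_le; [lra| |].
    { apply Ccont_plus; [exact HCd|]. destruct HCs as [C1 C2].
      split; [exact (continuity_opp _ C1)|exact (continuity_opp _ C2)]. }
    intros t _.
    assert (E : (w + RtoC y * cis t - (w + RtoC x * cis t) = RtoC (y - x) * cis t)%C)
      by (rewrite RtoC_minus; ring).
    replace (F (w + RtoC y * cis t) - F (w + RtoC x * cis t) -
       RtoC (y - x) * (cis t * F' (w + RtoC x * cis t)))%C with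
      (F (w + RtoC y * cis t) - F (w + RtoC x * cis t) -
       (w + RtoC y * cis t - (w + RtoC x * cis t)) * F' (w + RtoC x * cis t))%C
      by (rewrite E; ring).
    replace (y - x) with (Cmod (w + RtoC y * cis t - (w + RtoC x * cis t))).
    - apply HBF; (eapply Rle_trans; [apply Cmod_circle|]); lra.
    - rewrite E, Cmod_mult, Cmod_R, Cmod_cis, Rabs_right; lra. }
  unfold M in HM. rewrite HM.
  rewrite (CRInt_ext _ (fun _ => F w)).
  - rewrite CRInt_const, Rminus_0_r. reflexivity.
  - intros t. f_equal. ring.
Qed.

(** The factor 2 comes from integrating real and imaginary parts separately. It is harmless because
    the lemma is applied with [K] tending to 0. *)
Lemma Cmod_le_on_circle (F F' : C -> C) w r K : hasderiv F F' -> 0 <= r ->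
  (forall t, Cmod (F (w + RtoC r * cis t)%C) <= K) -> Cmod (F w) <= 2 * K.
Proof.
  intros HF Hr HK. assert (HP := PI_RGT_0).
  apply Rmult_le_reg_l with (2 * PI); [lra|].
  replace (2 * PI * Cmod (F w)) with (Cmod (RtoC (2 * PI) * F w))
    by (rewrite Cmod_mult, Cmod_R, Rabs_right; lra).
  rewrite (mean_value_property F F' w r HF Hr).
  replace (2 * PI * (2 * K)) with (2 * ((2 * PI - 0) * K)) by ring.
  apply Cmod_CRInt_le; [lra| |intros; apply HK].
  apply Ccont_comp; [exact (hasderiv_loclip _ _ HF)|apply Ccont_circle].
Qed.

(** * Uniqueness of analytic continuation from the real line *)

Lemma Ceq_0_of_le_div (z : C) K : (forall N, 1 <= N -> Cmod z <= K / N) -> z = 0.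
Proof.
  intros H. apply Cmod_eq_0, (eq_of_abs_le_div _ _ K). intros N HN.
  rewrite Rminus_0_r, Rabs_right; [apply H, HN|apply Rle_ge, Cmod_ge_0].
Qed.

Lemma hasderiv_vanishing_real F F' : hasderiv F F' -> (forall x : R, F (RtoC x) = 0) ->
  forall x : R, F' (RtoC x) = 0.
Proof.
  intros H H0 x. destruct (H (Rabs x + 1)) as [B [HB HF]].
  apply (Ceq_0_of_le_div _ B). intros N HN.
  assert (HN' : 0 < / N) by (apply Rinv_0_lt_compat; lra).
  assert (HN1 : / N <= 1) by (rewrite <- Rinv_1; apply Rinv_le_contravar; lra).
  assert (H1 := HF (RtoC x) (RtoC (x + / N))).
  rewrite !H0, !Cmod_R, <- (RtoC_minus (x + / N) x) in H1.
  replace (x + / N - x) with (/ N) in H1 by ring.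
  rewrite Cmod_R, (Rabs_right (/ N)) in H1 by lra.
  replace (0 - 0 - RtoC (/ N) * F' (RtoC x))%C with (- (RtoC (/ N) * F' (RtoC x)))%C in H1 by ring.
  rewrite Cmod_opp, Cmod_mult, Cmod_R, (Rabs_right (/ N)) in H1 by lra.
  apply Rmult_le_reg_l with (/ N); [exact HN'|].
  replace (/ N * (B / N)) with (B * (/ N) ^ 2) by (field; lra).
  apply H1; [lra|]. eapply Rle_trans; [apply Rabs_triang|]. rewrite (Rabs_right (/ N)); lra.
Qed.

Definition upper (F : C -> C) (z : C) : C := if Rle_dec 0 (snd z) then F z else 0.

Lemma Cmod_sub_real_part (z : C) : Cmod (z - RtoC (fst z)) = Rabs (snd z).
Proof.
  destruct z as [x y]. simpl snd. simpl fst. rewrite <- (sqrt_Rsqr_abs y). unfold Cmod; simpl. f_equal. unfold Rsqr. ring.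
Qed.

(** The critical case is a pair on opposite sides of the axis. The real projection [p] of the upper
    point is within |w - z| of it, and both F and F' vanish at [p]; so at the upper point F is O(|w
    - z|^2) and F' is O(|w - z|). *)
Lemma hasderiv_upper F F' : hasderiv F F' -> (forall x : R, F (RtoC x) = 0) ->
  hasderiv (upper F) (upper F').
Proof.
  intros H H0. assert (H0' := hasderiv_vanishing_real _ _ H H0).
  intros M. destruct (H M) as [B [HB HF]].
  destruct (hasderiv_loclip' _ _ H M) as [L [HL HLF]].
  assert (Hre : forall z, Cmod z <= M -> Cmod (RtoC (fst z)) <= M).
  { intros z Hz. rewrite Cmod_R. eapply Rle_trans; [apply abs_fst_le_Cmod|exact Hz]. }
  exists (B + 2 * L). split; [lra|]. intros z w Hz Hw.
  assert (Hd := Cmod_ge_0 (w - z)). assert (Hd2 := pow2_ge_0 (Cmod (w - z))).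
  assert (HLd : 0 <= L * Cmod (w - z) ^ 2) by (apply Rmult_le_pos; assumption).
  assert (HBd : 0 <= B * Cmod (w - z) ^ 2) by (apply Rmult_le_pos; assumption).
  rewrite Rmult_plus_distr_r.
  assert (Him := abs_snd_le_Cmod (w - z)). simpl in Him.
  unfold upper. destruct (Rle_dec 0 (snd z)) as [Dz|Dz], (Rle_dec 0 (snd w)) as [Dw|Dw].
  - assert (H1 := HF z w Hz Hw). lra.
  - set (p := RtoC (fst z)).
    assert (Hp : Cmod (z - p) <= Cmod (w - z)).
    { unfold p. rewrite Cmod_sub_real_part, Rabs_right by lra.
      rewrite Rabs_left in Him by lra. lra. }
    assert (H1 := HF z p Hz (Hre z Hz)). unfold p in H1 at 1. rewrite H0 in H1.
    replace (0 - F z - (w - z) * F' z)%C with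
      ((0 - F z - (p - z) * F' z) + (p - w) * F' z)%C by ring.
    apply Cmod_plus_le.
    + eapply Rle_trans; [exact H1|]. rewrite Cmod_sub_comm.
      apply Rmult_le_compat_l; [exact HB|]. apply pow_incr. split; [apply Cmod_ge_0|exact Hp].
    + replace (2 * L * Cmod (w - z) ^ 2) with ((2 * Cmod (w - z)) * (L * Cmod (w - z))) by ring.
      apply Cmod_mult_le.
      * replace (p - w)%C with (- (z - p) - (w - z))%C by ring.
        replace (2 * Cmod (w - z)) with (Cmod (w - z) + Cmod (w - z)) by ring.
        apply Cmod_minus_le; [rewrite Cmod_opp; exact Hp|apply Rle_refl].
      * assert (H2 := HLF p z (Hre z Hz) Hz). unfold p in H2 at 1. rewrite H0' in H2.
        replace (F' z - 0)%C with (F' z) in H2 by ring.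
        eapply Rle_trans; [exact H2|]. apply Rmult_le_compat_l; assumption.
  - set (p := RtoC (fst w)).
    assert (Hp : Cmod (w - p) <= Cmod (w - z)).
    { unfold p. rewrite Cmod_sub_real_part, Rabs_right by lra.
      rewrite Rabs_right in Him by lra. lra. }
    assert (H1 := HF p w (Hre w Hw) Hw). unfold p in H1 at 1 3. rewrite H0, H0' in H1.
    replace (F w - 0 - (w - p) * 0)%C with (F w - 0 - (w - z) * 0)%C in H1 by ring.
    assert (B * Cmod (w - p) ^ 2 <= B * Cmod (w - z) ^ 2).
    { apply Rmult_le_compat_l; [exact HB|]. apply pow_incr. split; [apply Cmod_ge_0|exact Hp]. }
    lra.
  - replace (0 - 0 - (w - z) * 0)%C with (RtoC 0) by ring. rewrite Cmod_0. lra.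
Qed.

(* The weight [exp (N (2 i z - z^2 + 7/16))] has modulus 1 at [i/4] and at most [exp (-N/2)] on the
   upper part of the unit circle around [i/4]; on its lower part [upper F] vanishes. *)
Lemma vanishing_real_at_quarter F F' : hasderiv F F' -> (forall x : R, F (RtoC x) = 0) ->
  F (0, 1 / 4) = 0.
Proof.
  intros H H0. assert (HU := hasderiv_upper _ _ H H0).
  destruct (loclip_bounded _ (hasderiv_loclip _ _ HU) 2) as [K [HK BK]].
  apply (Ceq_0_of_le_div _ (4 * K)). intros N HN.
  set (p := fun z : C => (RtoC N * (RtoC 2 * Ci * z + (RtoC (-1) * (z * z) + RtoC (7 / 16))))%C).
  assert (Hp : smooth 1 p).
  { apply smooth_scal. apply smooth_plus; [apply smooth_scal, smooth_id|].
    apply smooth_plus; [|apply smooth_const]. apply smooth_scal, smooth_mult; apply smooth_id. }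
  destruct Hp as [p' [Hp _]].
  assert (HE := hasderiv_comp _ _ _ _ hasderiv_Cexp Hp).
  assert (HW := hasderiv_mult _ _ _ _ HU HE).
  assert (Hexp : exp (- (N / 2)) <= 2 / N).
  { rewrite exp_Ropp. assert (H1 := exp_ineq1_le (N / 2)).
    replace (2 / N) with (/ (N / 2)) by (field; lra). apply Rinv_le_contravar; lra. }
  assert (Hc := Cmod_le_on_circle _ _ (0%R, (1 / 4)%R) 1 (K * exp (- (N / 2))) HW ltac:(lra)). cbv beta in Hc.
  replace (upper F (0%R, (1 / 4)%R) * Cexp (p (0%R, (1 / 4)%R)))%C with (F (0%R, (1 / 4)%R)) in Hc.
  - apply Rle_trans with (2 * (K * exp (- (N / 2)))).
    + apply Hc. intros t.
      replace ((0%R, (1 / 4)%R) + RtoC 1 * cis t)%C with ((cos t, 1 / 4 + sin t) : C)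
        by (unfold cis, Cplus, Cmult, RtoC; simpl; f_equal; ring).
      assert (E := sin2_cos2 t). assert (Bs := SIN_bound t). unfold Rsqr in E.
      unfold upper. destruct (Rle_dec 0 (snd (cos t, 1 / 4 + sin t))) as [D|D].
      * simpl in D. apply Cmod_mult_le.
        -- assert (HB := BK (cos t, 1 / 4 + sin t)). unfold upper in HB. simpl snd in HB.
           destruct (Rle_dec 0 (1 / 4 + sin t)) as [_|]; [|contradiction].
           apply HB. replace ((cos t, 1 / 4 + sin t) : C) with ((0%R, (1 / 4)%R) + RtoC 1 * cis t)%C
             by (unfold cis, Cplus, Cmult, RtoC; simpl; f_equal; ring).
           eapply Rle_trans; [apply Cmod_circle; lra|].
           assert (Hq := Cmod_le_sum (0%R, (1 / 4)%R)). simpl in Hq.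
           rewrite Rabs_R0, (Rabs_right (1 / 4)) in Hq by lra. lra.
        -- rewrite Cmod_Cexp.
           (* With s = sin t the exponent is N (2 s^2 - 3 s / 2 - 1). It is convex in s and equals
              -N / 2 at both ends of -1/4 <= s <= 1, the arc above the real axis. *)
           assert (Hfst : fst (p (cos t, 1 / 4 + sin t)) <= - (N / 2)).
           { unfold p, Cplus, Cmult, RtoC, Ci; simpl.
             match goal with |- ?X <= _ =>
               replace X with (N * (2 * (sin t * sin t) - 3 / 2 * sin t - 1
                 - (sin t * sin t + cos t * cos t - 1))) by field end.
             rewrite E. replace (- (N / 2)) with (N * - (1 / 2)) by field.
             apply Rmult_le_compat_l; [lra|]. nra. }
           destruct Hfst as [Hlt|Heq]; [left; apply exp_increasing, Hlt|rewrite Heq; apply Rle_refl].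
      * rewrite Cmult_0_l, Cmod_0. apply Rmult_le_pos; [exact HK|]. left; apply exp_pos.
    + replace (4 * K / N) with (2 * (K * (2 / N))) by (field; lra).
      apply Rmult_le_compat_l; [lra|]. apply Rmult_le_compat_l; assumption.
  - unfold upper. simpl snd. destruct (Rle_dec 0 (1 / 4)) as [_|]; [|lra].
    replace (p (0%R, (1 / 4)%R)) with (RtoC 0).
    + unfold Cexp; simpl. rewrite exp_0, cos_0, sin_0, Rmult_0_r, Rmult_1_l.
      change (F (0%R, (1 / 4)%R) = F (0%R, (1 / 4)%R) * RtoC 1)%C. ring.
    + unfold p, Cplus, Cmult, RtoC, Ci; simpl. f_equal; field.
Qed.

(** The map taking [z] to x + c z with real x and c preserves the real line and sends i/4 to x + i c
    / 4. With c = 4 Im z every point is reached, negative c covering the lower half-plane. *)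
Lemma identity_theorem F : smooth 1 F -> (forall x : R, F (RtoC x) = 0) -> forall z, F z = 0.
Proof.
  intros HF H0 z.
  assert (Hgen : forall (c x : R), F (RtoC x + RtoC c * (0%R, (1 / 4)%R))%C = 0).
  { intros c x.
    assert (Hs : smooth 1 (fun z => F (RtoC x + RtoC c * z)%C)).
    { apply (smooth_comp 1 F (fun z => (RtoC x + RtoC c * z)%C)); [exact HF|].
      apply (smooth_plus 1 (fun _ => RtoC x)); [apply smooth_const|apply smooth_scal, smooth_id]. }
    destruct Hs as [F' [Hs _]]. apply (vanishing_real_at_quarter _ F' Hs).
    intros t. rewrite <- RtoC_mult, <- RtoC_plus. apply H0. }
  rewrite <- (Hgen (4 * snd z) (fst z)). f_equal. destruct z as [x y].
  unfold Cplus, Cmult, RtoC; simpl. f_equal; field.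
Qed.

(** * Entire functions with an entire left inverse *)

(** The circle of radius N + |w| around [w] stays at distance at least N from 0, so F is at most K /
    N on it, and the mean value property carries the bound to [w]. *)
Lemma entire_tending_to_0 F K : smooth 1 F ->
  (forall z, 1 <= Cmod z -> Cmod (F z) <= K / Cmod z) -> forall z, F z = 0.
Proof.
  intros [F' [HF _]] HK w.
  assert (HK0 : 0 <= K).
  { specialize (HK 1). rewrite Cmod_1 in HK. assert (H1 := HK (Rle_refl 1)).
    assert (H2 := Cmod_ge_0 (F 1)). unfold Rdiv in H1. rewrite Rinv_1 in H1. lra. }
  apply (Ceq_0_of_le_div _ (2 * K)). intros N HN. assert (Hw := Cmod_ge_0 w).
  replace (2 * K / N) with (2 * (K / N)) by (field; lra).
  apply (Cmod_le_on_circle F F' w (N + Cmod w)); [exact HF|lra|].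
  intros t.
  assert (Hge : N <= Cmod (w + RtoC (N + Cmod w) * cis t)).
  { assert (H1 : Cmod (RtoC (N + Cmod w) * cis t) = N + Cmod w).
    { rewrite Cmod_mult, Cmod_R, Cmod_cis, Rabs_right; lra. }
    set (v := (RtoC (N + Cmod w) * cis t)%C) in *.
    assert (H2 : Cmod v <= Cmod (w + v) + Cmod w).
    { replace v with ((w + v) - w)%C at 1 by ring. apply Cmod_minus_le; apply Rle_refl. }
    lra. }
  eapply Rle_trans; [apply HK; lra|].
  apply Rmult_le_compat_l; [exact HK0|]. apply Rinv_le_contravar; lra.
Qed.

(** Two divided differences at 0 strip the constant and the linear term. What remains is (F z - a -
    b z) / z^2, entire and O(1 / |z|), hence 0. *)
Lemma entire_linear_growth F K : smooth 3 F ->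
  (forall z, 1 <= Cmod z -> Cmod (F z) <= K * Cmod z) ->
  exists a b, forall z, (F z = a + b * z)%C.
Proof.
  intros HF HK. destruct (smooth_divided_difference 2 F HF) as [F1 [S1 E1]].
  destruct (smooth_divided_difference 1 F1 S1) as [F2 [S2 E2]].
  exists (F 0), (F1 0).
  assert (E : forall z, (F z = F 0 + F1 0 * z + z * (z * F2 z))%C).
  { intros z. rewrite <- E2.
    replace (F z) with (F 0 + (F z - F 0))%C by ring. rewrite E1. ring. }
  assert (H2 : forall z, F2 z = 0).
  { apply (entire_tending_to_0 F2 (K + Cmod (F 0) + Cmod (F1 0)) S2). intros z Hz.
    apply Rle_div_r; [lra|].
    apply Rmult_le_reg_l with (Cmod z); [lra|].
    replace (Cmod z * (Cmod (F2 z) * Cmod z)) with (Cmod (z * (z * F2 z)))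
      by (rewrite !Cmod_mult; ring).
    replace (z * (z * F2 z))%C with (F z - F 0 - F1 0 * z)%C by (rewrite (E z); ring).
    replace (Cmod z * (K + Cmod (F 0) + Cmod (F1 0))) with
      (K * Cmod z + Cmod z * Cmod (F 0) + Cmod (F1 0) * Cmod z) by ring.
    apply Cmod_minus_le; [apply Cmod_minus_le|].
    - apply HK, Hz.
    - rewrite <- (Rmult_1_l (Cmod (F 0))) at 1.
      apply Rmult_le_compat_r; [apply Cmod_ge_0|exact Hz].
    - rewrite Cmod_mult. apply Rle_refl. }
  intros z. rewrite (E z), H2. ring.
Qed.

(* [g (G z) = z] forces [G z] to stay away from [G 0] for [|z| >= 1], so the entire function
   [z / (G z - G 0)], the difference quotient of [g] at [G z], has linear growth. *)
Lemma entire_left_inverse g G :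
  smooth 4 g -> smooth 3 G -> (forall z, g (G z) = z) ->
  exists a b, forall z, ((a + b * z) * (G z - G 0) = z)%C.
Proof.
  intros Hg HG Hinv.
  set (g1 := fun z => g (G 0 + z)%C).
  assert (Hg1 : smooth 4 g1).
  { apply (smooth_comp 4 g (fun z => (G 0 + z)%C)); [exact Hg|].
    apply (smooth_plus 4 (fun _ => G 0)); [apply smooth_const|apply smooth_id]. }
  assert (g10 : g1 0 = 0).
  { unfold g1. replace (G 0 + 0)%C with (G 0) by ring. apply Hinv. }
  destruct (smooth_divided_difference 3 g1 Hg1) as [k [Hk Ek]].
  set (Q := fun z => k (G z - G 0)%C).
  assert (HQ : smooth 3 Q).
  { apply (smooth_comp 3 k (fun z => (G z - G 0)%C)); [exact Hk|].
    apply (smooth_plus 3 G (fun _ => (- G 0)%C)); [exact HG|apply smooth_const]. }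
  assert (EQ : forall z, ((G z - G 0) * Q z = z)%C).
  { intros z. unfold Q. rewrite <- Ek, g10. unfold g1.
    replace (G 0 + (G z - G 0))%C with (G z) by ring. rewrite Hinv. ring. }
  destruct (smooth_loclip _ _ Hg1 1) as [L [HL HLg]].
  (* [L] is a Lipschitz constant of [g1] on the unit ball. If |G z - G 0| were below 1 / (L + 1),
     then z = g1 (G z - G 0) would have modulus below 1. *)
  assert (Hfar : forall z, 1 <= Cmod z -> 1 <= (L + 1) * Cmod (G z - G 0)).
  { intros z Hz. apply Rnot_lt_le. intros Hlt.
    assert (Hc := Cmod_ge_0 (G z - G 0)).
    assert (Hc1 : Cmod (G z - G 0) <= 1) by nra.
    assert (H1 := HLg 0 (G z - G 0)%C ltac:(rewrite Cmod_0; lra) Hc1).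
    rewrite g10 in H1. unfold g1 in H1.
    replace (G 0 + (G z - G 0))%C with (G z) in H1 by ring. rewrite Hinv in H1.
    replace (z - 0)%C with z in H1 by ring.
    replace (G z - G 0 - 0)%C with (G z - G 0)%C in H1 by ring. lra. }
  destruct (entire_linear_growth Q (L + 1) HQ) as [a [b Hab]].
  { intros z Hz. assert (H1 := Hfar z Hz).
    apply Rle_trans with ((L + 1) * Cmod (G z - G 0) * Cmod (Q z)).
    - rewrite <- (Rmult_1_l (Cmod (Q z))) at 1.
      apply Rmult_le_compat_r; [apply Cmod_ge_0|exact H1].
    - rewrite Rmult_assoc, <- Cmod_mult, EQ. apply Rle_refl. }
  exists a, b. intros z. rewrite <- Hab, Cmult_comm. apply EQ.
Qed.

(** * Entire extension of bandlimited functions *)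

Definition Ccos (z : C) : C := (RtoC (1 / 2) * (Cexp (Ci * z) + Cexp (- Ci * z)))%C.
Definition Csin (z : C) : C := (- Ci * RtoC (1 / 2) * (Cexp (Ci * z) + - (1) * Cexp (- Ci * z)))%C.

Lemma smooth_Cexp_scal n c : smooth n (fun z => Cexp (c * z)%C).
Proof.
  apply (smooth_comp n Cexp (fun z => c * z)%C); [apply smooth_Cexp|apply smooth_scal, smooth_id].
Qed.

Lemma smooth_Ccos n : smooth n Ccos.
Proof. apply smooth_scal, smooth_plus; apply smooth_Cexp_scal. Qed.

Lemma smooth_Csin n : smooth n Csin.
Proof.
  apply smooth_scal, smooth_plus; [|apply smooth_scal]; apply smooth_Cexp_scal.
Qed.

Lemma Cexp_Ci_RtoC (x : R) : Cexp (Ci * RtoC x) = (cos x, sin x).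
Proof.
  unfold Cexp, Ci, RtoC, Cmult; simpl.
  replace (0 * x - 1 * 0) with 0 by ring. replace (0 * 0 + 1 * x) with x by ring.
  rewrite exp_0, !Rmult_1_l. reflexivity.
Qed.

Lemma Cexp_opp_Ci_RtoC (x : R) : Cexp (- Ci * RtoC x) = (cos x, (- sin x)%R).
Proof.
  replace (- Ci * RtoC x)%C with (Ci * RtoC (- x))%C by (rewrite RtoC_opp; ring).
  rewrite Cexp_Ci_RtoC, cos_neg, sin_neg. reflexivity.
Qed.

Lemma Ccos_RtoC (x : R) : Ccos (RtoC x) = RtoC (cos x).
Proof.
  unfold Ccos. rewrite Cexp_Ci_RtoC, Cexp_opp_Ci_RtoC.
  unfold RtoC, Cmult, Cplus; simpl. f_equal; field.
Qed.

Lemma Csin_RtoC (x : R) : Csin (RtoC x) = RtoC (sin x).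
Proof.
  unfold Csin. rewrite Cexp_Ci_RtoC, Cexp_opp_Ci_RtoC.
  unfold RtoC, Cmult, Cplus, Copp, Ci; simpl. f_equal; field.
Qed.

Lemma CRInt_RtoC f a b : CRInt (fun t => RtoC (f t)) a b = RtoC (RInt f a b).
Proof.
  unfold CRInt, RtoC; simpl. f_equal. exact (eq_trans (RInt_Rconst 0 a b) (Rmult_0_r _)).
Qed.

(** The easy half of Paley-Wiener: the frequencies fill a compact interval, so cosine and sine may
    be evaluated at complex arguments without any question of convergence. *)
Lemma band_synthesis_extends f C b : decays f C -> 0 <= b ->
  exists F, (forall n, smooth n F) /\ forall u : R, F (RtoC u) = RtoC (band_synthesis f b u).
Proof.
  intros H Hb.
  assert (Hc : continuity (trans cos f)).
  { apply trans_continuity with C; [exact H|apply cos_lipschitz|apply abs_cos_le_1]. }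
  assert (Hs : continuity (trans sin f)).
  { apply trans_continuity with C; [exact H|apply sin_lipschitz|apply abs_sin_le_1]. }
  exists (fun z => RtoC (/ fejer_mass) *
    (CRInt (fun w => RtoC (trans cos f w) * Ccos (RtoC w * z)) 0 b +
     CRInt (fun w => RtoC (trans sin f w) * Csin (RtoC w * z)) 0 b))%C.
  split.
  - intros n. apply smooth_scal, smooth_plus; apply smooth_integral; try assumption.
    + apply smooth_Ccos.
    + apply smooth_Csin.
  - intros u.
    rewrite (CRInt_ext _ (fun w => RtoC (trans cos f w * cos (w * u)))).
    2:{ intros w. rewrite <- RtoC_mult, Ccos_RtoC, <- RtoC_mult. reflexivity. }
    rewrite (CRInt_ext (fun w => RtoC (trans sin f w) * Csin (RtoC w * RtoC u))%C
      (fun w => RtoC (trans sin f w * sin (w * u)))).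
    2:{ intros w. rewrite <- RtoC_mult, Csin_RtoC, <- RtoC_mult. reflexivity. }
    rewrite !CRInt_RtoC, <- RtoC_plus, <- RtoC_mult. unfold band_synthesis.
    assert (cc : continuity (fun w => cos (w * u))).
    { apply (continuity_lipschitz _ (Rabs u)). intros x y. eapply Rle_trans; [apply cos_lipschitz|].
      rewrite <- Rmult_minus_distr_r, Rabs_mult, Rmult_comm. apply Rle_refl. }
    assert (cs : continuity (fun w => sin (w * u))).
    { apply (continuity_lipschitz _ (Rabs u)). intros x y. eapply Rle_trans; [apply sin_lipschitz|].
      rewrite <- Rmult_minus_distr_r, Rabs_mult, Rmult_comm. apply Rle_refl. }
    rewrite RInt_Rplus; [reflexivity| |]; apply ex_RInt_continuity.
    + exact (continuity_mult _ _ Hc cc).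
    + exact (continuity_mult _ _ Hs cs).
Qed.

Lemma continuity_real_restriction (F : C -> C) (f : R -> R) :
  loclip F -> (forall u : R, F (RtoC u) = RtoC (f u)) -> continuity f.
Proof.
  intros HF E.
  assert (Hid : continuity (fun t : R => t)).
  { intros t. apply derivable_continuous_pt, derivable_pt_id. }
  destruct (Ccont_comp F RtoC HF (Ccont_RtoC _ Hid)) as [H _].
  intros t eps He. destruct (H t eps He) as [d [Hd Hs]]. exists d. split; [exact Hd|].
  intros s Hst. specialize (Hs s Hst). rewrite !E in Hs. exact Hs.
Qed.

Lemma vanishing_above f C b : decays f C ->
  (forall xi, Rabs xi > b / (2 * PI) -> fourier_vanishes_at f xi) ->
  forall w, b < w -> 0 < w -> trans cos f w = 0 /\ trans sin f w = 0.
Proof.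
  intros H Hv w Hw Hw0. assert (HP := PI_RGT_0).
  replace w with (2 * PI * (w / (2 * PI))) by (field; lra).
  apply fourier_vanishes_trans with C; [exact H|]. apply Hv.
  rewrite Rabs_right.
  - apply Rmult_lt_compat_r; [|exact Hw]. apply Rinv_0_lt_compat; lra.
  - apply Rle_ge, Rdiv_le_0_compat; lra.
Qed.

Lemma continuous_bandlimited_synthesis f C b : decays f C -> 0 < b -> continuity f ->
  (forall xi, Rabs xi > b / (2 * PI) -> fourier_vanishes_at f xi) ->
  forall t, band_synthesis f b t = f t.
Proof.
  intros H Hb Hc Hv t. apply (eq_of_abs_le_div _ _ 1). intros N HN.
  destruct (continuity_eps f t (1 / N) Hc) as [d [Hd Hs]]; [apply Rdiv_lt_0_compat; lra|].
  apply fourier_inversion with C d; [exact H|exact Hb| |exact Hd|].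
  - intros w Hw. apply (vanishing_above f C b H Hv); lra.
  - intros x Hx. left. apply Hs, Hx.
Qed.

(* [h] is not known to be continuous, but it is continuous up to any [e] at a dense set of points,
   where [fourier_inversion] applies. *)
Lemma bandlimited_synthesis_dense h C b u0 d e :
  decays h C -> 0 < b ->
  (forall xi, Rabs xi > b / (2 * PI) -> fourier_vanishes_at h xi) ->
  0 < d -> 0 < e ->
  exists u, Rabs (u - u0) < d /\ Rabs (band_synthesis h b u - h u) <= e.
Proof.
  intros H Hb Hv Hd He.
  destruct (ex_RInt_small_oscillation h (u0 - d) (u0 + d) e (proj1 H _ _) ltac:(lra) He)
    as [u [d' [Hu [Hd' Hosc]]]].
  exists u. split; [apply Rabs_def1; lra|].
  apply fourier_inversion with C d'; try assumption.
  intros w Hw. apply (vanishing_above h C b H Hv); lra.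
Qed.

(** If q were nonzero, the zero -p / q of the affine factor would have to be 0, so p = 0 and d would
    be the constant 1 / q off 0, too far from x / al for large x. With q = 0, d is x / p, and
    boundedness forces p = al. The test points are chosen to make the deviation exceed [D]. *)
Lemma linear_of_reciprocal_linear (d : R -> R) (p q al D : R) :
  0 < al -> (forall x, (p + q * x) * d x = x) -> (forall x, Rabs (d x - x / al) <= D) ->
  forall x, d x = x / al.
Proof.
  intros Hal Hd HD.
  assert (HD0 : 0 <= D) by (eapply Rle_trans; [apply Rabs_pos|apply (HD 0)]).
  assert (Hq : q = 0).
  { destruct (Req_dec q 0) as [E|E]; [exact E|exfalso].
    assert (H1 := Hd (- p / q)).
    replace (p + q * (- p / q)) with 0 in H1 by (field; exact E).
    assert (Hp : p = 0).
    { replace p with (- q * (- p / q)) by (field; exact E). rewrite <- H1. ring. }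
    set (x := al * (Rabs (/ q) + D + 1)). assert (Ha := Rabs_pos (/ q)).
    assert (Hx : 0 < x) by (apply Rmult_lt_0_compat; lra).
    assert (H2 := Hd x). rewrite Hp in H2.
    assert (Hdx : d x = / q).
    { apply Rmult_eq_reg_l with (q * x); [|apply Rmult_integral_contrapositive_currified; lra].
      replace (q * x * / q) with x by (field; exact E). lra. }
    assert (H3 := HD x). rewrite Hdx in H3. apply Rabs_le_between in H3.
    replace (x / al) with (Rabs (/ q) + D + 1) in H3 by (unfold x; field; lra).
    assert (H4 := Rle_abs (/ q)). lra. }
  subst q.
  assert (Hp : p <> 0).
  { intros ->. specialize (Hd 1). lra. }
  assert (Hdx : forall x, d x = x / p).
  { intros x. apply Rmult_eq_reg_l with p; [|exact Hp].
    replace (p * (x / p)) with x by (field; exact Hp). rewrite <- (Hd x) at 2. ring. }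
  assert (Hpa : / p - / al = 0).
  { destruct (Req_dec (/ p - / al) 0) as [E|E]; [exact E|exfalso].
    set (c := / p - / al) in *. assert (H1 := HD ((D + 1) / c)). rewrite Hdx in H1.
    replace ((D + 1) / c / p - (D + 1) / c / al) with ((D + 1) / c * c) in H1
      by (unfold c at 2; field; repeat split; try assumption; lra).
    replace ((D + 1) / c * c) with (D + 1) in H1 by (field; exact E).
    rewrite Rabs_right in H1; lra. }
  intros x. rewrite Hdx. unfold Rdiv. f_equal. lra.
Qed.

(** * Rigidity of [g] and its inverse *)

Theorem theorem3 (sigma A : R) (f : R -> R)
  (Hsigma : 0 < sigma) (HA : 0 < A)
  (Hcont : continuity f)
  (Hband : bandlimited f sigma)
  (Hbound : forall t : R, Rabs (f t) <= A / (1 + t ^ 2))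
  (Hnz : exists t : R, f t <> 0) :
  exists alpha0 : R, forall alpha : R, A * sigma < alpha -> alpha <> alpha0 ->
    forall ginv : R -> R,
      (forall u : R, alpha * ginv u + f (ginv u) = u) ->
      ~ bandlimited_some (fun u => ginv u - u / alpha).
Proof.
  exists 0. intros alpha Halpha _ ginv Hginv [tau [Htau Hvan]].
  assert (HP := PI_RGT_0).
  assert (Hal : 0 < alpha) by (assert (0 < A * sigma) by (apply Rmult_lt_0_compat; assumption); lra).
  assert (Hf : decays f A).
  { split; [intros; apply ex_RInt_continuity, Hcont|exact Hbound]. }
  assert (HfA : forall t, Rabs (f t) <= A) by (intros t; apply (decays_bounded _ _ t Hf)).
  set (h := fun u => ginv u - u / alpha) in *.
  assert (Eh : forall u, h u = - / alpha * f (ginv u)).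
  { intros u. unfold h. rewrite <- (Hginv u) at 2. field. lra. }
  (* The decay of [f] is in v = ginv u. From u = alpha v + f v and |f| <= A follows u^2 <= 2 alpha^2
     v^2 + 2 A^2, which turns it into decay in [u]. *)
  assert (Hh : decays h (/ alpha * A * (1 + 2 * alpha ^ 2 + 2 * A ^ 2))).
  { split.
    - intros a b. apply fourier_vanishes_ex_RInt with (tau + 1). apply Hvan.
      rewrite Rabs_right; lra.
    - intros u. rewrite Eh, Rabs_mult, Rabs_Ropp, Rabs_right.
      2:{ left. apply Rinv_0_lt_compat, Hal. }
      unfold Rdiv. rewrite !Rmult_assoc. apply Rmult_le_compat_l; [left; apply Rinv_0_lt_compat, Hal|].
      eapply Rle_trans; [apply Hbound|]. apply Rmult_le_compat_l; [lra|].
      assert (Hu : 1 + u ^ 2 <= (1 + 2 * alpha ^ 2 + 2 * A ^ 2) * (1 + ginv u ^ 2)).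
      { set (v := ginv u). assert (Ev : u = alpha * v + f v) by (symmetry; apply Hginv).
        assert (Hfv : f v ^ 2 <= A ^ 2).
        { rewrite <- (pow2_abs (f v)). apply pow_incr. split; [apply Rabs_pos|apply HfA]. }
        assert (H1 := pow2_ge_0 (alpha * v - f v)). assert (H2 := pow2_ge_0 v).
        assert (H3 := pow2_ge_0 alpha). assert (H4 : 0 <= A ^ 2 * v ^ 2) by (apply Rmult_le_pos; [apply pow2_ge_0|exact H2]).
        assert (H5 : u ^ 2 <= 2 * alpha ^ 2 * v ^ 2 + 2 * A ^ 2) by (rewrite Ev; nra).
        nra. }
      assert (H1 := pow2_ge_0 u). assert (H2 := pow2_ge_0 (ginv u)).
      apply Rmult_le_reg_r with (1 + ginv u ^ 2); [lra|].
      rewrite Rinv_l by lra. apply Rmult_le_reg_l with (1 + u ^ 2); [lra|].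
      replace ((1 + u ^ 2) * ((1 + 2 * alpha ^ 2 + 2 * A ^ 2) * / (1 + u ^ 2) * (1 + ginv u ^ 2)))
        with ((1 + 2 * alpha ^ 2 + 2 * A ^ 2) * (1 + ginv u ^ 2)) by (field; lra). lra. }
  set (Ch := / alpha * A * (1 + 2 * alpha ^ 2 + 2 * A ^ 2)) in *.
  (* [tau] bounds the frequency xi, while [b] is the corresponding bound in rad/s. *)
  set (b := 2 * PI * tau). assert (Hb : 0 < b) by (apply Rmult_lt_0_compat; [lra|exact Htau]).
  assert (Hvan' : forall xi, Rabs xi > b / (2 * PI) -> fourier_vanishes_at h xi).
  { intros xi Hxi. apply Hvan. unfold b in Hxi.
    replace (2 * PI * tau / (2 * PI)) with tau in Hxi by (field; lra). exact Hxi. }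
  destruct (band_synthesis_extends f A sigma Hf ltac:(lra)) as [F [SF EF]].
  destruct (band_synthesis_extends h Ch b Hh ltac:(lra)) as [H [SH EH]].
  assert (EF' : forall u : R, F (RtoC u) = RtoC (f u)).
  { intros u. rewrite EF. f_equal.
    apply (continuous_bandlimited_synthesis f A sigma Hf Hsigma Hcont (proj2 Hband)). }
  set (ht := band_synthesis h b) in *.
  assert (Cht := continuity_real_restriction H ht (SH O) EH).
  set (G := fun u => u / alpha + ht u).
  (* Near [u0] there is a [u] at which [ht] and [h] almost agree, so that [ginv u] is close to [G u]
     and hence to [G u0]. The equation for [ginv u] passes to the limit; the error (2 + alpha) / N
     adds |u - u0|, alpha |ginv u - G u0| and the variation of [f], each kept small through 1 /
     N. *)
  assert (HG : forall u, alpha * G u + f (G u) = u).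
  { intros u0. apply (eq_of_abs_le_div _ _ (2 + alpha)). intros N HN.
    assert (HN' : 0 < / N) by (apply Rinv_0_lt_compat; lra).
    assert (Hia : 0 < / alpha) by (apply Rinv_0_lt_compat, Hal).
    destruct (continuity_eps f (G u0) (/ N) Hcont HN') as [d1 [Hd1 C1]].
    set (d := Rmin d1 (/ N)). assert (Hd : 0 < d) by (apply Rmin_glb_lt; assumption).
    assert (d <= d1) by apply Rmin_l. assert (d <= / N) by apply Rmin_r.
    assert (CG : continuity G).
    { apply (continuity_plus (fun u => u / alpha) ht); [|exact Cht].
      intros u. apply derivable_continuous_pt, ex_derive_Reals_0. auto_derive. exact I. }
    destruct (continuity_eps G u0 (d / 2) CG ltac:(lra)) as [d2 [Hd2 C2]].
    destruct (bandlimited_synthesis_dense h Ch b u0 (Rmin d2 (/ N)) (d / 4) Hh Hb Hvan'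
      ltac:(apply Rmin_glb_lt; assumption) ltac:(lra)) as [u [Hu1 Hu2]].
    fold ht in Hu2.
    assert (Hu3 := C2 u (Rlt_le_trans _ _ _ Hu1 (Rmin_l _ _))).
    assert (Hu4 := Rlt_le_trans _ _ _ Hu1 (Rmin_r _ _)).
    assert (Hgi : Rabs (ginv u - G u0) < d).
    { replace (ginv u) with (u / alpha + h u) by (unfold h; ring).
      replace (u / alpha + h u - G u0) with ((G u - G u0) - (ht u - h u)) by (unfold G; ring).
      apply Rabs_le_between in Hu2. apply Rabs_def2 in Hu3. apply Rabs_def1; lra. }
    assert (Hu5 := C1 (ginv u) ltac:(lra)).
    replace (alpha * G u0 + f (G u0) - u0) with
      ((u - u0) - (alpha * (ginv u - G u0) + (f (ginv u) - f (G u0))))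
      by (rewrite <- (Hginv u) at 1; ring).
    assert (Hm : Rabs (alpha * (ginv u - G u0)) <= alpha * / N).
    { rewrite Rabs_mult, (Rabs_right alpha) by lra. apply Rmult_le_compat_l; lra. }
    replace ((2 + alpha) / N) with (/ N + alpha * / N + / N) by (field; lra).
    apply Rabs_le_between in Hm. apply Rabs_def2 in Hu4, Hu5. apply Rabs_le; lra. }
  set (gc := fun z => (RtoC alpha * z + F z)%C).
  set (Gc := fun z => (RtoC (/ alpha) * z + H z)%C).
  assert (Sg : forall n, smooth n gc).
  { intros n. apply smooth_plus; [apply smooth_scal, smooth_id|apply SF]. }
  assert (SG : forall n, smooth n Gc).
  { intros n. apply smooth_plus; [apply smooth_scal, smooth_id|apply SH]. }
  assert (EG : forall u : R, Gc (RtoC u) = RtoC (G u)).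
  { intros u. unfold Gc. rewrite EH, <- RtoC_mult, <- RtoC_plus. f_equal. unfold G, Rdiv. ring. }
  assert (Hinv : forall z, gc (Gc z) = z).
  { intros z.
    assert (H0 := identity_theorem (fun z => (gc (Gc z) + RtoC (-1) * z)%C)).
    replace (gc (Gc z)) with (gc (Gc z) + RtoC (-1) * z + z)%C by ring.
    rewrite H0.
    - ring.
    - apply (smooth_plus 1 (fun z => gc (Gc z))); [apply smooth_comp; auto|apply smooth_scal, smooth_id].
    - intros u. rewrite EG. unfold gc. rewrite EF', <- !RtoC_mult, <- !RtoC_plus. f_equal.
      rewrite HG. ring. }
  destruct (entire_left_inverse gc Gc (Sg 4%nat) (SG 3%nat) Hinv) as [p [q Hpq]].
  (* This transfers the bound on [f] to [ht], which yields the boundedness of G x - x / alpha. *)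
  assert (Hht : forall u, ht u = - / alpha * f (G u)).
  { intros u. assert (H1 : G u = u / alpha + ht u) by reflexivity.
    apply Rmult_eq_reg_l with alpha; [|lra].
    replace (alpha * (- / alpha * f (G u))) with (- f (G u)) by (field; lra).
    assert (H2 := HG u). assert (H3 : alpha * G u = u + alpha * ht u) by (rewrite H1; field; lra).
    lra. }
  assert (Hlin : forall x, G x - G 0 = x / alpha).
  (* The coefficients [p] and [q] are complex, but x and G x - G 0 are real, so the real part of the
     identity involves only their real parts. *)
  { apply (linear_of_reciprocal_linear (fun x => G x - G 0) (fst p) (fst q) alpha (2 * (/ alpha * A)) Hal).
    - intros x. assert (H1 := Hpq (RtoC x)). rewrite !EG, <- RtoC_minus in H1.
      apply (f_equal fst) in H1. simpl in H1. rewrite <- H1 at 3. ring.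
    - intros x. unfold G.
      replace (x / alpha + ht x - (0 / alpha + ht 0) - x / alpha) with (ht x - ht 0) by (field; lra).
      assert (Hb1 : forall u, Rabs (ht u) <= / alpha * A).
      { intros u. rewrite Hht, Rabs_mult, Rabs_Ropp, Rabs_right.
        - apply Rmult_le_compat_l; [left; apply Rinv_0_lt_compat, Hal|apply HfA].
        - left. apply Rinv_0_lt_compat, Hal. }
      assert (H1 := Hb1 x). assert (H2 := Hb1 0).
      apply Rabs_le_between in H1, H2. apply Rabs_le. lra. }
  (* Now G u = u / alpha + ht 0, so every real [t] is a value of [G], with explicit preimage alpha
     (t - ht 0). *)
  assert (Hconst : forall t, f t = - alpha * ht 0).
  { intros t.
    assert (Ex : G (alpha * (t - ht 0)) = t).
    { assert (H1 := Hlin (alpha * (t - ht 0))).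
      replace (G 0) with (ht 0) in H1 by (unfold G; field; lra).
      replace (alpha * (t - ht 0) / alpha) with (t - ht 0) in H1 by (field; lra). lra. }
    assert (H1 := HG (alpha * (t - ht 0))). rewrite Ex in H1. lra. }
  destruct Hnz as [t0 Ht0]. apply Ht0.
  apply (eq_of_abs_le_div _ _ A). intros N HN.
  (* By constancy the value at [t0] is the value at [N], and there the decay gives A / (1 + N^2) <=
     A / N. *)
  rewrite Rminus_0_r, Hconst, <- (Hconst N). eapply Rle_trans; [apply Hbound|].
  apply Rmult_le_compat_l; [lra|]. apply Rinv_le_contravar; [lra|]. nra.
Qed.
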